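(* For every integer $n\ge 1$ the $(n+8)$-point quadrature formula $$Q_{n+8}[f]=\frac{11}{12n}\sigma(0)-\frac{3}{2n}\sigma\Big(\frac1{12n}\Big)+\frac{3}{4n}\sigma\Big(\frac1{6n}\Big)-\frac{1}{6n}\sigma\Big(\frac1{4n}\Big)+\frac1n\sum_{k=1}^{n}f\Big(\frac{2k-1}{2n}\Big),\qquad \sigma(x):=f(x)+f(1-x),$$ is negative definite of order $4$, with error constant $$c_4(Q_{n+8})=-\frac{7}{5760\,n^4}\Big(1-\frac{5}{504\,n}\Big),$$ and the sequence $\{Q_{n+8}\}$ is asymptotically optimal negative definite of order $4$, i.e. $\lim_{n\to\infty}c_4(Q_{n+8})/c^{-}_{n+8,4}=1$.
   Context: An $N$-point quadrature formula is a functional $Q[f]=\sum_{i=1}^{N}a_i f(\tau_i)$ with nodes $0\le\tau_1<\dots<\tau_N\le 1$ and real weights; its remainder is $R[Q;f]=\int_0^1 f(x)\,dx-Q[f]$. $Q$ is negative definite of order $4$, with error constant $c_4(Q)$, if there is a constant $c_4(Q)<0$ such that for every $f\in C^4[0,1]$ there is $\xi\in[0,1]$ with $R[Q;f]=c_4(Q)f^{(4)}(\xi)$. $c^{-}_{N,4}$ denotes the supremum (largest negative value) of $c_4(Q)$ over all $N$-point negative definite quadrature formulae $Q$ of order $4$. *)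

(* Defs.v *)
From Stdlib Require Import Reals.
From Coquelicot Require Import Coquelicot.
Open Scope R_scope.

Definition unit_interval (x : R) : Prop := 0 <= x <= 1.

(* [Ck_on D k f g]: f is of class C^k on D, with k-th derivative g on D.
   Derivatives and continuity are relative to D, hence one-sided at the
   endpoints of a compact interval; values outside D play no role. *)
Fixpoint Ck_on (D : R -> Prop) (k : nat) (f g : R -> R) : Prop :=
  match k with
  | O => (forall x, D x -> continue_in f D x) /\ (forall x, D x -> g x = f x)
  | S k' => exists f' : R -> R,
      (forall x, D x -> D_in f f' D x) /\ Ck_on D k' f' g
  end.

(* Nodes and weights are indexed by 1, ..., N. *)
Definition quadrature_formula (N : nat) (Q : (R -> R) -> R) : Prop :=
  exists a tau : nat -> R,
    (forall i, (1 <= i <= N)%nat -> 0 <= tau i <= 1) /\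
    (forall i j, (1 <= i)%nat -> (i < j)%nat -> (j <= N)%nat -> tau i < tau j) /\
    (forall f, Q f = sum_n_m (fun i => a i * f (tau i)) 1 N).

Definition remainder (Q : (R -> R) -> R) (f : R -> R) : R := RInt f 0 1 - Q f.

(* Q is negative definite of order r with error constant c.  The constant is
   determined by Q: taking f x = x ^ r / r! gives c = remainder Q f. *)
Definition negative_definite (r : nat) (Q : (R -> R) -> R) (c : R) : Prop :=
  c < 0 /\
  forall f fr : R -> R, Ck_on unit_interval r f fr ->
    exists xi : R, 0 <= xi <= 1 /\ remainder Q f = c * fr xi.

(* The set is bounded above by 0, so the supremum is finite as soon as some
   N-point negative definite formula of order r exists. *)
Definition c_minus (N r : nat) : R :=
  real (Lub_Rbar (fun c => exists Q : (R -> R) -> R,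
                     quadrature_formula N Q /\ negative_definite r Q c)).

(* For a sequence Q 1, Q 2, ... in which Q n is an (N n)-point formula. *)
Definition asymptotically_optimal_negative_definite
    (r : nat) (N : nat -> nat) (Q : nat -> (R -> R) -> R) : Prop :=
  exists c : nat -> R,
    (forall n, (1 <= n)%nat ->
       quadrature_formula (N n) (Q n) /\ negative_definite r (Q n) (c n)) /\
    is_lim_seq (fun n => c n / c_minus (N n) r) 1.

Definition sigma (f : R -> R) (x : R) : R := f x + f (1 - x).

(* The (n + 8)-point formula, indexed by n. *)
Definition Qmid (n : nat) (f : R -> R) : R :=
  11 / (12 * INR n) * sigma f 0
  - 3 / (2 * INR n) * sigma f (1 / (12 * INR n))
  + 3 / (4 * INR n) * sigma f (1 / (6 * INR n))
  - 1 / (6 * INR n) * sigma f (1 / (4 * INR n))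
  + 1 / INR n * sum_n_m (fun k => f ((2 * INR k - 1) / (2 * INR n))) 1 n.

(* Main.v *)
Require Import Defs.
From Stdlib Require Import Reals Lra Lia.
From Coquelicot Require Import Coquelicot.
Open Scope R_scope.

(* Negative definiteness.  The Peano kernel K of the rule is C^2, is -h^4/24 (u^2/2 - u^4) with
   h = 1/n in the middle (u = distance to the nearest multiple of h, divided by h), and is
   modified near 0 and 1 because the nodes at 0, h/12, h/6, h/4 replace f'(0) by a difference
   formula.  It is nonpositive, and K f''' - K' f'' + K'' f' - K''' f + (integral of f) has
   derivative K f'''' between the nodes, so it decreases when f'''' >= 0.

   Optimality.  Let K <= 0 be the kernel of an arbitrary N-point negative definite rule, with
   cells between consecutive nodes.  On a cell, K is a quartic determined by the values K0, K1
   and K0', K1' at the two ends.  Subtracting a suitable multiple of K(y) <= 0 at a suitable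
   point y of the cell from the integral of K turns the coefficients of K0', K1' into any
   prescribed -g0, g1 with g0, g1 >= 0, which telescopes if g belongs to the node.  The g's are
   chosen so that the coefficients of K at each interior node add up to 0; this monotone system
   is solved by the largest subsolution.  In the scale 1/N (l = N * length, g = x/(24 N^2)) the
   integral of -K is then at least the sum of [cell_gain]/(5760 N^5), and [cell_inequality]
   gives [cell_gain] >= 35 l - 28 up to terms which cancel at the interior nodes.  Summation
   gives c <= -7/(5760 N^4). *)

(** * The inequality for one cell *)

(** With [x = l^2*u] and [y = l^2*v], homogeneity turns [cell_gain l x y] into
    [l^5 * gain_ratio u v] and [cell_gap l x y] into [l * u * gap_ratio u v]. *)
Definition gain_ratio (u v : R) := (10*u*v+12*(u+v)+8)/(u+v+4).
Definition gap_ratio (u v : R) := ((u+2)^2/(v+2) + 3*(u+2) - 12)/u.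

(** Equality holds at [u = v = 1], where [gain_ratio] is 7 and [gap_ratio] is 0. The claim is
    symmetric, hence a polynomial inequality in [s = u+v] and [p = u*v]. *)
Lemma gap_ratio_sum_le u v : 0 < u <= 8 -> 0 < v <= 8 ->
  5/8*(gap_ratio u v + gap_ratio v u) <= 7 - 49 / gain_ratio u v.
Proof.
intros Hu Hv.
set (s := u+v). set (p := u*v).
assert (Hs : 0 < s) by (unfold s; lra).
assert (Hp : 0 < p) by (apply Rmult_lt_0_compat; lra).
assert (Hsp : 4*p <= s^2) by (unfold s, p; pose proof (pow2_ge_0 (u-v)); lra).
assert (Hp64 : p <= 64) by (unfold p; nra).
assert (Hsp2 : s <= 8 + p/8) by (unfold s, p; nra).
assert (E : 7 - 49 / gain_ratio u v - 5/8*(gap_ratio u v + gap_ratio v u) =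
  (((16/5)*p + 4*s)*(10*p+12*s+8)*(p+2*s+4) - (392/5)*(s+4)*p*(p+2*s+4) - (s^2-4*p)*(p-4)*(10*p+12*s+8)) / (8/5*p*(10*p+12*s+8)*(p+2*s+4))).
{ unfold gain_ratio, gap_ratio, s, p. field. repeat split; nra. }
cut (0 <= 7 - 49 / gain_ratio u v - 5/8*(gap_ratio u v + gap_ratio v u)); [lra|].
rewrite E. apply Rmult_le_pos; [|apply Rlt_le, Rinv_0_lt_compat; repeat apply Rmult_lt_0_compat; lra].
clear E. clearbody s p. clear u v Hu Hv.
(* The factor [p+s] makes the numerator a multiple of [(2*p+s-4)^2] plus a multiple of the
   discriminant [s^2-4*p]; both vanish at [u = v = 1]. *)
apply (Rmult_le_reg_l (p+s)); [lra|].
rewrite Rmult_0_r.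
match goal with |- 0 <= ?t => replace t with (8*(p*(p+2*s+4))*(2*p+s-4)^2 + (10*p+12*s+8)*((s^2-4*p)*((12-p)*s+16+8*p-p^2))) by field end.
destruct (Rle_dec p 9) as [H9|H9].
- assert (H : 0 <= (12-p)*s+16+8*p-p^2) by nra.
  apply Rplus_le_le_0_compat; apply Rmult_le_pos; try lra.
  + assert (0 <= p*(p+2*s+4)) by (apply Rmult_le_pos; lra). lra.
  + apply pow2_ge_0.
  + apply Rmult_le_pos; lra.
(* Here the last factor [Z] can be negative. Since [(8-u)*(8-v) >= 0], the discriminant is at most
   48; as [10*p+12*s+8 <= 10*(p+2*s+4)], the square term wins once [480*(-Z) <= 8*p*(2*p+s-4)^2]. *)
- assert (s^2-4*p <= (8-p/8)^2) by nra.
  assert ((8-p/8)^2 <= 48) by nra.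
  assert (H1 : 480*(p^2+p*s-8*p-12*s-16) <= 8*p*(2*p+s-4)^2).
  { assert (0 <= s*(32*p^2-544*p+5760)) by (apply Rmult_le_pos; nra).
    assert (0 <= p*(p^2-19*p+124)) by (apply Rmult_le_pos; nra).
    assert (0 <= p*s^2) by (apply Rmult_le_pos; [lra|apply pow2_ge_0]).
    lra. }
  set (Z := (12-p)*s+16+8*p-p^2) in *.
  assert (H2 : 480*(-Z) <= 8*p*(2*p+s-4)^2) by (unfold Z; lra).
  clearbody Z.
  assert (He : 0 <= s^2-4*p <= 48) by lra.
  set (e := s^2-4*p) in *.
  assert (H3 : 0 <= 8*p*(2*p+s-4)^2).
  { apply Rmult_le_pos; [lra|apply pow2_ge_0]. }
  assert (H4 : 48 * Rmin 0 Z <= e * Z).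
  { unfold Rmin; destruct (Rle_dec 0 Z).
    - rewrite Rmult_0_r; apply Rmult_le_pos; lra.
    - clear - He n; nra. }
  assert (H5 : 480 * (- Rmin 0 Z) <= 8*p*(2*p+s-4)^2).
  { unfold Rmin; destruct (Rle_dec 0 Z); lra. }
  assert (H6 : Rmin 0 Z <= 0) by apply Rmin_l.
  set (Y := (2*p+s-4)^2) in *. set (z := Rmin 0 Z) in *. clearbody Y z e.
  assert (H7 : (10*p+12*s+8)*(48*z) <= (10*p+12*s+8)*(e*Z)).
  { apply Rmult_le_compat_l; lra. }
  assert (H8 : (p+2*s+4)*(480*(-z)) <= (p+2*s+4)*(8*p*Y)).
  { apply Rmult_le_compat_l; lra. }
  nra.
Qed.

(** Completing the square in [l^3]; contact is at [P*l^3 = K], so [K] is tuned to the critical cell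
    of each case. *)
Lemma sextic_tangent P K l : 0 < P -> 2*K*l^3 - K^2/P <= P*l^6.
Proof.
intros HP.
cut (0 <= P*l^6 - 2*K*l^3 + K^2/P); [lra|].
replace (P*l^6 - 2*K*l^3 + K^2/P) with ((P*l^3-K)^2/P) by (field; lra).
apply Rmult_le_pos; [apply pow2_ge_0|apply Rlt_le, Rinv_0_lt_compat, HP].
Qed.

Lemma gain_ratio_gt0 u v : 0 <= u -> 0 <= v -> 0 < gain_ratio u v.
Proof.
intros Hu Hv; assert (0 <= u*v) by (apply Rmult_le_pos; lra).
apply Rmult_lt_0_compat; [lra|apply Rinv_0_lt_compat; lra].
Qed.

Lemma gain_ratio_ge u v w : 0 < u -> 0 <= w <= v -> gain_ratio u w <= gain_ratio u v.
Proof.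
intros Hu Hv; unfold gain_ratio.
cut (0 <= (10 * u * v + 12 * (u + v) + 8) / (u + v + 4) - (10 * u * w + 12 * (u + w) + 8) / (u + w + 4)); [lra|].
replace (_ - _) with (10*(u+2)^2*(v-w)/((u+v+4)*(u+w+4))) by (field; lra).
apply Rmult_le_pos; [apply Rmult_le_pos; [|lra]|apply Rlt_le, Rinv_0_lt_compat; nra].
apply Rmult_le_pos; [lra|apply pow2_ge_0].
Qed.

Lemma gap_ratio_anti u v w : 0 < u -> 0 <= w <= v -> gap_ratio u v <= gap_ratio u w.
Proof.
intros Hu Hv; unfold gap_ratio.
apply Rmult_le_compat_r; [apply Rlt_le, Rinv_0_lt_compat, Hu|].
do 2 apply Rplus_le_compat_r.
apply Rmult_le_compat_l; [apply pow2_ge_0|apply Rinv_le_contravar; lra].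
Qed.

Lemma gain_ratio_sym u v : gain_ratio u v = gain_ratio v u.
Proof. unfold gain_ratio; f_equal; ring. Qed.

(** The tangent with [K = 7] is exact at [l = u = v = 1], and what remains is
    [7*(l-1)^2*(2*l-1)]. *)
Lemma unclamped_cell_bound l u v : 1/2 <= l -> 0 < u <= 8 -> 0 < v <= 8 ->
  0 <= gain_ratio u v * l^6 - 35*l^2 + 28*l - 5/8*(gap_ratio u v + gap_ratio v u).
Proof.
intros Hl Hu Hv.
assert (HP : 0 < gain_ratio u v) by (apply gain_ratio_gt0; lra).
generalize (sextic_tangent (gain_ratio u v) 7 l HP) (gap_ratio_sum_le u v Hu Hv).
replace (7^2) with 49 by ring.
assert (0 <= (l-1)^2*(2*l-1)) by (apply Rmult_le_pos; [apply pow2_ge_0|lra]).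
intros; nra.
Qed.

(** The transfer at the [u] end is replaced by its cap, whence [91/4 = 28 - 21/4]. After the tangent
    with [K = 9], the cubic in [l] is smallest at [l = 1/2], with value [39/8]. *)
Lemma one_clamped_cell_bound l u v : 1/2 <= l -> 8 <= u -> 0 < v <= u ->
  0 <= gain_ratio u v * l^6 - 35*l^2 + 91/4*l - 5/8*gap_ratio v u.
Proof.
intros Hl Hu Hv.
assert (HP : 0 < gain_ratio u v) by (apply gain_ratio_gt0; lra).
generalize (sextic_tangent (gain_ratio u v) 9 l HP).
assert (Hc : 39/8 <= 18*l^3-35*l^2+91/4*l).
{ cut (0 <= (l-1/2)*(18*l^2-26*l+39/4)); [nra|]. apply Rmult_le_pos; [lra|]. pose proof (pow2_ge_0 (l-13/18)); lra. }
cut (81 / gain_ratio u v + 5/8*gap_ratio v u <= 39/8).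
{ replace (9^2) with 81 by ring. nra. }
destruct (Rle_dec v 8) as [H8|H8].
- assert (H1 : gain_ratio 8 v <= gain_ratio u v).
  { rewrite (gain_ratio_sym u), (gain_ratio_sym 8). apply gain_ratio_ge; lra. }
  assert (H2 : gap_ratio v u <= gap_ratio v 8) by (apply gap_ratio_anti; lra).
  assert (H0 : 0 < gain_ratio 8 v) by (apply gain_ratio_gt0; lra).
  assert (H3 : 81 / gain_ratio u v <= 81 / gain_ratio 8 v).
  { apply Rmult_le_compat_l; [lra|apply Rinv_le_contravar; lra]. }
  cut (0 <= 39/8 - (81 / gain_ratio 8 v + 5/8*gap_ratio v 8)); [lra|].
  unfold gain_ratio, gap_ratio.
  match goal with |- 0 <= ?t => replace t with ((-(16*81*v*(v+12)) + 16*(92*v+104)*(11/4*v-v^2/16+7/2))/(16*v*(92*v+104))) by (field; lra) end.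
  apply Rmult_le_pos; [|apply Rlt_le, Rinv_0_lt_compat; nra].
  assert (0 <= v^2*(8-v)) by (apply Rmult_le_pos; [apply pow2_ge_0|lra]).
  pose proof (pow2_ge_0 (v-3/2)); lra.
- assert (H1 : gain_ratio 8 8 <= gain_ratio u v).
  { apply Rle_trans with (gain_ratio u 8); [|apply gain_ratio_ge; lra].
    rewrite (gain_ratio_sym u). apply gain_ratio_ge; lra. }
  assert (H2 : gap_ratio v u <= gap_ratio v v) by (apply gap_ratio_anti; lra).
  assert (H3 : 81 / gain_ratio u v <= 81 / gain_ratio 8 8).
  { apply Rmult_le_compat_l; [lra|apply Rinv_le_contravar; [unfold gain_ratio|]; lra]. }
  assert (H4 : gap_ratio v v <= 4).
  { unfold gap_ratio. replace (_ / v) with (4 - 4/v) by (field; lra).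
    assert (0 < / v) by (apply Rinv_0_lt_compat; lra). unfold Rdiv; lra. }
  assert (H5 : 81 / gain_ratio 8 8 <= 2) by (unfold gain_ratio; lra).
  lra.
Qed.

(** The transfer at the [v] end is cut off at [-21/4], whence [133/4 = 28 + 21/4]. By monotonicity
    [v] may then be replaced by 0. *)
Lemma low_clamped_cell_bound l u v : 1/2 <= l -> 0 < u -> 0 < v ->
  0 <= gain_ratio u v * l^6 - 35*l^2 + 133/4*l - Rmin (21/4*l) (5/8*gap_ratio u v).
Proof.
intros Hl Hu Hv.
assert (H1 : gain_ratio u 0 <= gain_ratio u v) by (apply gain_ratio_ge; lra).
assert (H2 : gap_ratio u v <= gap_ratio u 0) by (apply gap_ratio_anti; lra).
assert (H0 : 0 < gain_ratio u 0) by (apply gain_ratio_gt0; lra).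
assert (H3 : gain_ratio u 0 * l^6 <= gain_ratio u v * l^6).
{ apply Rmult_le_compat_r; [apply pow_le|]; lra. }
assert (H6 : 0 <= gain_ratio u 0 * l^6).
{ apply Rmult_le_pos; [|apply pow_le]; lra. }
assert (Hm1 := Rmin_l (21/4*l) (5/8*gap_ratio u v)).
assert (Hm2 := Rmin_r (21/4*l) (5/8*gap_ratio u v)).
(* With the bound [21/4*l] for the minimum, the terms other than the gain add up to
   [35*l*(4/5-l)]. *)
destruct (Rle_dec l (4/5)) as [Hl8|Hl8]; [nra|].
destruct (Rle_dec u 4) as [H4|H4].
- assert (H7 := sextic_tangent (gain_ratio u 0) 6 l H0).
  (* The cubic has its local minimum near [l = 28/25], and [1019/100] is that minimum rounded
     down. *)
  assert (Hc : 1019/100 <= 12*l^3-35*l^2+133/4*l).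
  { assert (0 <= (l-28/25)^2*(12*l-203/25)) by (apply Rmult_le_pos; [apply pow2_ge_0|lra]).
    lra. }
  cut (36/gain_ratio u 0 + 5/8*gap_ratio u 0 <= 1019/100).
  { replace (6^2) with 36 in * by ring. lra. }
  cut (0 <= 1019/100 - (36 / gain_ratio u 0 + 5/8*gap_ratio u 0)); [lra|].
  unfold gain_ratio, gap_ratio.
  match goal with |- 0 <= ?t => replace t with ((1019/100*(12*u+8)*u - 36*u*(u+4) - (12*u+8)*(25/8*u+5/16*u^2-5/2))/(u*(12*u+8))) by (field; lra) end.
  apply Rmult_le_pos; [|apply Rlt_le, Rinv_0_lt_compat; nra].
  assert (0 <= (4-u)*(u-3/4)^2) by (apply Rmult_le_pos; [lra|apply pow2_ge_0]).
  pose proof (pow2_ge_0 (u-16/25)); lra.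
- assert (H7 := sextic_tangent (gain_ratio u 0) 7 l H0).
  assert (0 <= (l-1)^2*(2*l-1)) by (apply Rmult_le_pos; [apply pow2_ge_0|lra]).
  assert (H8 : 49 / gain_ratio u 0 <= 7).
  { apply Rle_trans with (49 / 7); [|lra].
    apply Rmult_le_compat_l; [lra|apply Rinv_le_contravar; [lra|]].
    unfold gain_ratio. apply (Rmult_le_reg_r (u+0+4)); [lra|].
    unfold Rdiv; rewrite Rmult_assoc, Rinv_l by lra. lra. }
  replace (7^2) with 49 in * by ring. nra.
Qed.

(** Up to the factor [-h^5/5760], the constant term of [hermite_combination] for a cell of length
    [h*l] with [A0 = h^2*(2*l^2+x)/24] and [A1 = h^2*(2*l^2+y)/24]. *)
Definition cell_gain (l x y : R) : R :=
  10*l^3*((2*l^2+x)*(2*l^2+y)/((2*l^2+x)+(2*l^2+y))) - 8*l^5.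

(** Up to the factor [-h/24], the coefficient in that identity of the kernel value at the end
    carrying [x]. *)
Definition cell_gap (l x y : R) : R :=
  (2*l^2+x)*((2*l^2+x)+3*(2*l^2+y))/(l*(2*l^2+y)) - 12*l.

Definition clamp (b z : R) : R := Rmax (-b) (Rmin b z).

(* The factor [5/8] is forced by equality in [cell_inequality] at [l = x = y = 1]; the bound [21/4]
   makes that inequality trivial for [l <= 1/2]. *)
Definition transfer (x g : R) : R := clamp (21/4) (5/8*g/x).

Lemma transfer_opp x g : transfer x (-g) = - transfer x g.
Proof.
unfold transfer, clamp; replace (5/8*-g/x) with (-(5/8*g/x)) by (unfold Rdiv; ring).
generalize (5/8*g/x); intros z.
unfold Rmax, Rmin; repeat destruct Rle_dec; lra.
Qed.

Lemma transfer_bound x g : -(21/4) <= transfer x g <= 21/4.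
Proof.
unfold transfer, clamp; generalize (5/8*g/x); intros z.
unfold Rmax, Rmin; repeat destruct Rle_dec; lra.
Qed.

Lemma cell_gain_ratio l u v : 0 < l -> 0 < u -> 0 < v ->
  cell_gain l (l^2*u) (l^2*v) = l^5 * gain_ratio u v.
Proof.
intros Hl Hu Hv; unfold cell_gain, gain_ratio; field.
split; [lra|].
assert (0 < l^2) by (apply pow_lt, Hl).
assert (0 < l^2*u) by (apply Rmult_lt_0_compat; lra).
assert (0 < l^2*v) by (apply Rmult_lt_0_compat; lra). lra.
Qed.

Lemma cell_gap_ratio l u v : 0 < l -> 0 < u -> 0 < v ->
  l * (5/8*cell_gap l (l^2*u) (l^2*v)/(l^2*u)) = 5/8 * gap_ratio u v.
Proof.
intros Hl Hu Hv; unfold cell_gap, gap_ratio; field.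
assert (0 < l^2) by (apply pow_lt, Hl).
assert (0 < l^2*v) by (apply Rmult_lt_0_compat; lra). repeat split; lra.
Qed.

(** After multiplication by [l] and scaling of [x], [y] by [l^2], the cases are: which transfers are
    cut off below, and, if none is, which of [u], [v] exceed 8, where the cap [21/4] serves as the
    bound. *)
Lemma cell_inequality l x y : 0 < l -> 0 < x -> 0 < y ->
  35*l - 28 + transfer x (cell_gap l x y) + transfer y (cell_gap l y x) <= cell_gain l x y.
Proof.
intros Hl Hx Hy.
assert (Hl2 : 0 < l^2) by (apply pow_lt, Hl).
assert (Eu : exists u, 0 < u /\ x = l^2*u).
{ exists (x/l^2); split; [apply Rdiv_lt_0_compat; lra|field; lra]. }
assert (Ev : exists v, 0 < v /\ y = l^2*v).
{ exists (y/l^2); split; [apply Rdiv_lt_0_compat; lra|field; lra]. }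
destruct Eu as [u [Hu ->]], Ev as [v [Hv ->]].
rewrite cell_gain_ratio by lra.
unfold transfer.
assert (HA := cell_gap_ratio l u v Hl Hu Hv).
assert (HB := cell_gap_ratio l v u Hl Hv Hu).
set (A := 5/8*cell_gap l (l^2*u) (l^2*v)/(l^2*u)) in *.
set (B := 5/8*cell_gap l (l^2*v) (l^2*u)/(l^2*v)) in *.
clearbody A B; clear Hx Hy Hl2.
assert (HP := gain_ratio_gt0 u v (Rlt_le _ _ Hu) (Rlt_le _ _ Hv)).
assert (clamp_le : forall z, clamp (21/4) z <= 21/4).
{ intros z; unfold clamp, Rmax, Rmin; repeat destruct Rle_dec; lra. }
assert (clamp_min : forall z, -(21/4) <= z -> clamp (21/4) z <= Rmin (21/4) z).
{ intros z; unfold clamp, Rmax, Rmin; repeat destruct Rle_dec; lra. }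
assert (clamp_low : forall z, z < -(21/4) -> clamp (21/4) z = -(21/4)).
{ intros z; unfold clamp, Rmax, Rmin; repeat destruct Rle_dec; lra. }
assert (HcA := clamp_le A). assert (HcB := clamp_le B).
assert (HD : 0 <= l^5*gain_ratio u v) by (apply Rmult_le_pos; [apply pow_le|]; lra).
destruct (Rle_dec l (1/2)) as [Hl2|Hl2]; [lra|].
assert (scaled_min : forall z, l * Rmin (21/4) z = Rmin (21/4*l) (l*z)).
{ intros z; unfold Rmin; destruct (Rle_dec (21/4) z), (Rle_dec (21/4*l) (l*z)); try lra; nra. }
apply (Rmult_le_reg_l l); [exact Hl|].
replace (l * (l^5*gain_ratio u v)) with (gain_ratio u v * l^6) by ring.
destruct (Rlt_dec A (-(21/4))) as [A1|A1]; destruct (Rlt_dec B (-(21/4))) as [B1|B1].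
- rewrite !clamp_low by assumption.
  assert (H2 : 2 <= gain_ratio u v).
  { replace 2 with (gain_ratio 0 0) by (unfold gain_ratio; field).
    apply Rle_trans with (gain_ratio u 0); [rewrite (gain_ratio_sym u); unfold gain_ratio|apply gain_ratio_ge; lra].
    apply (Rmult_le_reg_r (u+4)); [lra|].
    replace (_ * (u+4)) with (2*(u+4)) by field.
    match goal with |- _ <= ?t => replace t with (12*u+8) by (field; lra) end. lra. }
  assert (2*l^6 <= gain_ratio u v*l^6) by (apply Rmult_le_compat_r; [apply pow_le|]; lra).
  assert (0 <= l*(2*l^5+77/2-35*l)); [|lra].
  apply Rmult_le_pos; [lra|].
  (* The tangent line of [2*l^5] at [171/125], close to the minimizer [(7/2)^(1/4)] of
     [2*l^5 - 35*l]. *)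
  assert (0 <= (l-171/125)^2*(2*l^3+684/125*l^2+6*(171/125)^2*l+8*(171/125)^3)).
  { apply Rmult_le_pos; [apply pow2_ge_0|].
    assert (0 < l^3) by (apply pow_lt, Hl). assert (0 < l^2) by (apply pow_lt, Hl). lra. }
  lra.
- rewrite (clamp_low A) by assumption.
  assert (HC := low_clamped_cell_bound l v u ltac:(lra) Hv Hu).
  rewrite <- HB, <- scaled_min, (gain_ratio_sym v) in HC.
  assert (l*clamp (21/4) B <= l * Rmin (21/4) B) by (apply Rmult_le_compat_l; [lra|apply clamp_min; lra]).
  lra.
- rewrite (clamp_low B) by assumption.
  assert (HC := low_clamped_cell_bound l u v ltac:(lra) Hu Hv).
  rewrite <- HA, <- scaled_min in HC.
  assert (l*clamp (21/4) A <= l * Rmin (21/4) A) by (apply Rmult_le_compat_l; [lra|apply clamp_min; lra]).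
  lra.
- assert (l*clamp (21/4) A <= l * A).
  { apply Rmult_le_compat_l; [lra|].
    apply Rle_trans with (1 := clamp_min A ltac:(lra)), Rmin_r. }
  assert (l*clamp (21/4) B <= l * B).
  { apply Rmult_le_compat_l; [lra|].
    apply Rle_trans with (1 := clamp_min B ltac:(lra)), Rmin_r. }
  assert (l*clamp (21/4) A <= l * (21/4)) by (apply Rmult_le_compat_l; lra).
  assert (l*clamp (21/4) B <= l * (21/4)) by (apply Rmult_le_compat_l; lra).
  destruct (Rle_dec u 8) as [u8|u8]; destruct (Rle_dec v 8) as [v8|v8].
  + assert (HC := unclamped_cell_bound l u v ltac:(lra) ltac:(lra) ltac:(lra)). lra.
  + assert (HC := one_clamped_cell_bound l v u ltac:(lra) ltac:(lra) ltac:(lra)).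
    rewrite gain_ratio_sym in HC. lra.
  + assert (HC := one_clamped_cell_bound l u v ltac:(lra) ltac:(lra) ltac:(lra)). lra.
  + destruct (Rle_dec v u) as [vu|vu].
    * assert (HC := one_clamped_cell_bound l u v ltac:(lra) ltac:(lra) ltac:(lra)). lra.
    * assert (HC := one_clamped_cell_bound l v u ltac:(lra) ltac:(lra) ltac:(lra)).
      rewrite gain_ratio_sym in HC. lra.
Qed.

(** * Balanced potentials *)

Lemma cell_gap_expand l r c : 0 < l -> 0 <= c ->
  cell_gap l r c = (2*l^2+r)^2*/(l*(2*l^2+c)) + 3*(2*l^2+r)/l - 12*l.
Proof.
intros Hl Hc; assert (0 < l^2) by (apply pow_lt, Hl).
unfold cell_gap; field; lra.
Qed.

Lemma cell_gap_anti l r c d : 0 < l -> 0 <= c <= d -> cell_gap l r d <= cell_gap l r c.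
Proof.
intros Hl Hc; rewrite !cell_gap_expand by lra.
assert (0 < l^2) by (apply pow_lt, Hl).
do 2 apply Rplus_le_compat_r.
apply Rmult_le_compat_l; [apply pow2_ge_0|apply Rinv_le_contravar; nra].
Qed.

Lemma cell_gap_ge l r c : 0 < l -> 0 <= c -> 3*r/l - 6*l <= cell_gap l r c.
Proof.
intros Hl Hc; rewrite cell_gap_expand by lra.
assert (0 < l^2) by (apply pow_lt, Hl).
assert (0 <= (2*l^2+r)^2*/(l*(2*l^2+c))).
{ apply Rmult_le_pos; [apply pow2_ge_0|apply Rlt_le, Rinv_0_lt_compat; nra]. }
replace (3*(2*l^2+r)/l) with (6*l+3*r/l) by (field; lra). lra.
Qed.

Lemma cell_gap_0_lt0 l c : 0 < l -> 0 <= c -> cell_gap l 0 c < 0.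
Proof.
intros Hl Hc; apply Rle_lt_trans with (cell_gap l 0 0); [apply cell_gap_anti; lra|].
unfold cell_gap. replace (_ - _) with (-4*l) by (field; lra). lra.
Qed.

Lemma cell_gap_continuous l r c : 0 < l -> 0 <= c -> continuous (fun r => cell_gap l r c) r.
Proof.
intros Hl Hc.
apply (continuous_ext (fun r => (2*l^2+r)^2*/(l*(2*l^2+c)) + 3*(2*l^2+r)/l - 12*l)).
{ intros; symmetry; apply cell_gap_expand; lra. }
apply @ex_derive_continuous. auto_derive; trivial.
Qed.

Section Balance.

Variables (M : nat) (lam : nat -> R).
Hypothesis lam_gt0 : forall i, (i < M)%nat -> 0 < lam i.
Hypothesis M_gt0 : (0 < M)%nat.

(** Cell [i] joins nodes [i] and [i+1]; this is the total gap at the interior node [i+1] when the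
    potential there is [r]. *)
Definition balance (z : nat -> R) (i : nat) (r : R) : R :=
  cell_gap (lam i) r (z i) + cell_gap (lam (S i)) r (z (S (S i))).

(** A discrete Perron method: boundary values fixed at 1, and the pointwise supremum of all
    subsolutions will be the solution. *)
Definition subsolution (z : nat -> R) : Prop :=
  z 0%nat = 1 /\ z M = 1 /\ (forall i, (i <= M)%nat -> 0 <= z i) /\
  (forall i, (S i < M)%nat -> balance z i (z (S i)) <= 0).

Let max_subsolution i : R := real (Lub_Rbar (fun r => exists z, subsolution z /\ r = z i)).

Lemma subsolution_exists : exists z, subsolution z.
Proof.
(* The value 0 at every interior node works: each gap there is negative whatever the neighbour
   is. *)
set (z := fun i => if Nat.eqb i 0 then 1 else if Nat.eqb i M then 1 else 0).
assert (Hz : forall i, 0 <= z i).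
{ intros i; unfold z; destruct (Nat.eqb i 0), (Nat.eqb i M); lra. }
exists z; repeat split; trivial.
- unfold z; destruct M; [lia|]. now rewrite Nat.eqb_refl.
- intros i Hi; unfold balance.
  replace (z (S i)) with 0.
  2:{ unfold z; now destruct (Nat.eqb_spec (S i) 0), (Nat.eqb_spec (S i) M); try lia. }
  assert (H1 := cell_gap_0_lt0 (lam i) (z i) (lam_gt0 i ltac:(lia)) (Hz i)).
  assert (H2 := cell_gap_0_lt0 (lam (S i)) (z (S (S i))) (lam_gt0 (S i) ltac:(lia)) (Hz _)).
  lra.
Qed.

(** Each gap is at least [3*r/l - 6*l] whatever the neighbour is, so a nonpositive balance between
    cells of lengths [l] and [m] forces [r <= 2*l*m]. *)
Lemma subsolution_bounded i : (i <= M)%nat ->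
  exists B, forall z, subsolution z -> z i <= B.
Proof.
intros Hi.
destruct i as [|i]; [exists 1; intros z [-> _]; lra|].
destruct (Nat.eq_dec (S i) M) as [E|E]; [exists 1; rewrite E; intros z (_ & -> & _); lra|].
exists (2 * lam i * lam (S i)).
intros z (_ & _ & Hz & Hb).
assert (Hb' := Hb i ltac:(lia)); unfold balance in Hb'.
assert (H1 := lam_gt0 i ltac:(lia)). assert (H2 := lam_gt0 (S i) ltac:(lia)).
assert (H3 := cell_gap_ge (lam i) (z (S i)) (z i) H1 (Hz i ltac:(lia))).
assert (H4 := cell_gap_ge (lam (S i)) (z (S i)) (z (S (S i))) H2 (Hz (S (S i)) ltac:(lia))).
set (l := lam i) in *. set (m := lam (S i)) in *. set (r := z (S i)) in *.
assert (H5 : 3*(l+m)*(r-2*l*m)/(l*m) <= 0).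
{ replace (3*(l+m)*(r-2*l*m)/(l*m)) with (3*r/l-6*l + (3*r/m-6*m)) by (field; lra). lra. }
apply Rnot_lt_le; intros Hr.
assert (0 < 3*(l+m)*(r-2*l*m)/(l*m)); [|lra].
apply Rdiv_lt_0_compat; [apply Rmult_lt_0_compat; lra|apply Rmult_lt_0_compat; lra].
Qed.

Lemma max_subsolution_lub i : (i <= M)%nat -> is_lub (fun r => exists z, subsolution z /\ r = z i) (max_subsolution i).
Proof.
intros Hi; destruct (subsolution_bounded i Hi) as [B HB].
destruct subsolution_exists as [z0 Hz0].
assert (HL := Lub_Rbar_correct (fun r => exists z, subsolution z /\ r = z i)).
unfold max_subsolution; destruct (Lub_Rbar _) as [s| |]; destruct HL as [Hub Hleast].
- split.
  + intros r Hr; apply (Hub r Hr).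
  + intros b Hb. apply (Hleast (Finite b)). intros r Hr; apply (Hb r Hr).
- exfalso. apply (Hleast (Finite B)). intros r (z & Hz & ->); apply HB, Hz.
- exfalso. apply (Hub (z0 i)). now exists z0.
Qed.

Lemma max_subsolution_ge z i : (i <= M)%nat -> subsolution z -> z i <= max_subsolution i.
Proof. intros Hi Hz; apply (proj1 (max_subsolution_lub i Hi)); now exists z. Qed.

Lemma max_subsolution_ge0 i : (i <= M)%nat -> 0 <= max_subsolution i.
Proof.
intros Hi; destruct subsolution_exists as [z Hz].
apply Rle_trans with (z i); [apply Hz, Hi|now apply max_subsolution_ge].
Qed.

Lemma max_subsolution_end i : (i <= M)%nat -> (forall z, subsolution z -> z i = 1) -> max_subsolution i = 1.
Proof.
intros Hi H1; destruct subsolution_exists as [z Hz].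
apply Rle_antisym.
- apply (proj2 (max_subsolution_lub i Hi)); intros r (w & Hw & ->); rewrite H1 by assumption; lra.
- rewrite <- (H1 z Hz); now apply max_subsolution_ge.
Qed.

Lemma balance_anti z w i r : (S i < M)%nat -> 0 <= z i <= w i -> 0 <= z (S (S i)) <= w (S (S i)) ->
  balance w i r <= balance z i r.
Proof.
intros Hi H1 H2; apply Rplus_le_compat; apply cell_gap_anti; trivial; apply lam_gt0; lia.
Qed.

Lemma balance_max_subsolution_near i (P : R -> Prop) : (S i < M)%nat ->
  locally (balance max_subsolution i (max_subsolution (S i))) P ->
  exists d : posreal, forall r, Rabs (r - max_subsolution (S i)) < d -> P (balance max_subsolution i r).
Proof.
intros Hi HP.
assert (C : continuous (balance max_subsolution i) (max_subsolution (S i))).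
{ unfold balance. apply @continuous_plus; apply cell_gap_continuous;
    try (apply lam_gt0; lia); apply max_subsolution_ge0; lia. }
destruct (C P HP) as [d Hd]; exists d; intros r Hr; apply Hd, Hr.
Qed.

(** If the balance were positive, it would stay so at [z (S i)] for some subsolution [z] nearly
    maximal at that node. The neighbours of [z] are no larger than the suprema, so the balance of
    [z] would be positive as well. *)
Lemma max_subsolution_balance_le0 i : (S i < M)%nat -> balance max_subsolution i (max_subsolution (S i)) <= 0.
Proof.
intros Hi; apply Rnot_lt_le; intros Hlt.
  destruct (balance_max_subsolution_near i (fun t => 0 < t) Hi) as [d Hd].
  { apply (open_gt 0), Hlt. }
  assert (Hz : exists z, subsolution z /\ max_subsolution (S i) - d < z (S i)).
  { apply Classical_Prop.NNPP; intros Hn.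
    assert (max_subsolution (S i) <= max_subsolution (S i) - d); [|destruct d; simpl in *; lra].
    apply (proj2 (max_subsolution_lub (S i) ltac:(lia))).
    intros r (z & Hz & ->). apply Rnot_lt_le; intros Hr; apply Hn; now exists z. }
  destruct Hz as (z & Hz & Hzd).
  assert (Hzt := max_subsolution_ge z (S i) ltac:(lia) Hz).
  assert (H1 : 0 < balance max_subsolution i (z (S i))).
  { apply Hd. rewrite Rabs_left1; lra. }
  destruct Hz as (z0 & zM & Hpos & Hbal).
  assert (Hz : subsolution z) by (repeat split; assumption).
  assert (H2 := Hbal i Hi).
  assert (H3 : balance max_subsolution i (z (S i)) <= balance z i (z (S i))).
  { apply balance_anti; trivial; split; try (apply Hpos; lia); apply max_subsolution_ge; trivial; lia. }
  lra.
Qed.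

(** If the balance were negative, the value at this node could be raised slightly; that only lowers
    the balances at the adjacent nodes, so a larger subsolution would result. *)
Lemma max_subsolution_balanced i : (S i < M)%nat -> balance max_subsolution i (max_subsolution (S i)) = 0.
Proof.
intros Hi; apply Rle_antisym; [now apply max_subsolution_balance_le0|apply Rnot_lt_le; intros Hlt].
  destruct (balance_max_subsolution_near i (fun t => t < 0) Hi) as [d Hd].
  { apply (open_lt 0), Hlt. }
  set (r := max_subsolution (S i) + d/2).
  set (z := fun j => if Nat.eqb j (S i) then r else max_subsolution j).
  assert (Hd0 := cond_pos d).
  assert (Hle : forall j, max_subsolution j <= z j).
  { intros j; unfold z; destruct (Nat.eqb_spec j (S i)) as [->|]; unfold r; lra. }
  assert (Hne : forall j, j <> S i -> z j = max_subsolution j).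
  { intros j Hj; unfold z; now destruct (Nat.eqb_spec j (S i)). }
  assert (Hzr : z (S i) = r) by (unfold z; now rewrite Nat.eqb_refl).
  assert (Hz : subsolution z).
  { repeat split.
    - rewrite Hne by lia. apply max_subsolution_end; [lia|]. intros w Hw; apply Hw.
    - rewrite Hne by lia. apply max_subsolution_end; [lia|]. intros w Hw; apply Hw.
    - intros j Hj; apply Rle_trans with (max_subsolution j); [now apply max_subsolution_ge0|apply Hle].
    - intros j Hj; destruct (Nat.eq_dec j i) as [->|Hji].
      + rewrite Hzr; unfold balance; rewrite !Hne by lia.
        apply Rlt_le, Hd. unfold r; rewrite Rabs_pos_eq; lra.
      + rewrite (Hne (S j)) by lia.
        apply Rle_trans with (balance max_subsolution j (max_subsolution (S j))).
        * apply balance_anti; trivial; split; try apply Hle; apply max_subsolution_ge0; lia.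
        * now apply max_subsolution_balance_le0. }
  assert (Hrt := max_subsolution_ge z (S i) ltac:(lia) Hz). rewrite Hzr in Hrt; unfold r in Hrt; lra.
Qed.

Lemma max_subsolution_gt0 i : (i <= M)%nat -> 0 < max_subsolution i.
Proof.
intros Hi; destruct (Nat.eq_dec i 0) as [->|Hi0].
{ rewrite max_subsolution_end; [lra|lia|]. intros w Hw; apply Hw. }
destruct (Nat.eq_dec i M) as [->|HiM].
{ rewrite max_subsolution_end; [lra|lia|]. intros w Hw; apply Hw. }
destruct i as [|i]; [lia|].
destruct (Rle_lt_or_eq_dec 0 (max_subsolution (S i)) (max_subsolution_ge0 _ Hi)) as [|E]; trivial.
assert (Hb := max_subsolution_balanced i ltac:(lia)); unfold balance in Hb; rewrite <- E in Hb.
assert (H1 := cell_gap_0_lt0 (lam i) (max_subsolution i) (lam_gt0 i ltac:(lia)) (max_subsolution_ge0 i ltac:(lia))).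
assert (H2 := cell_gap_0_lt0 (lam (S i)) (max_subsolution (S (S i))) (lam_gt0 (S i) ltac:(lia)) (max_subsolution_ge0 (S (S i)) ltac:(lia))).
lra.
Qed.

End Balance.

Lemma balanced_potentials_exist (M : nat) (lam : nat -> R) : (0 < M)%nat ->
  (forall i, (i < M)%nat -> 0 < lam i) ->
  exists x : nat -> R, (forall i, (i <= M)%nat -> 0 < x i) /\
    forall i, (S i < M)%nat ->
      cell_gap (lam i) (x (S i)) (x i) + cell_gap (lam (S i)) (x (S i)) (x (S (S i))) = 0.
Proof.
intros HM Hlam; eexists; split.
- intros i; apply max_subsolution_gt0; eassumption.
- intros i; apply max_subsolution_balanced; assumption.
Qed.

(* The transfers at an interior node cancel because the two gaps there are opposite. *)
Lemma balanced_gain (M : nat) (lam x : nat -> R) : (0 < M)%nat ->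
  (forall i, (i < M)%nat -> 0 < lam i) -> (forall i, (i <= M)%nat -> 0 < x i) ->
  (forall i, (S i < M)%nat ->
     cell_gap (lam i) (x (S i)) (x i) + cell_gap (lam (S i)) (x (S i)) (x (S (S i))) = 0) ->
  35 * sum_n_m lam 0 (pred M) - 28 * INR M - 21/2 <=
    sum_n_m (fun i => cell_gain (lam i) (x i) (x (S i))) 0 (pred M).
Proof.
intros HM Hlam Hx Hb.
assert (Hcell := fun i (Hi : (i < M)%nat) =>
  cell_inequality (lam i) (x i) (x (S i)) (Hlam i Hi) (Hx i ltac:(lia)) (Hx (S i) ltac:(lia))).
cut (forall m, (m < M)%nat ->
  35 * sum_n_m lam 0 m - 28 * INR (S m) - 21/4
    + transfer (x (S m)) (cell_gap (lam m) (x (S m)) (x m)) <=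
  sum_n_m (fun i => cell_gain (lam i) (x i) (x (S i))) 0 m).
{ intros H; assert (H1 := H (pred M) ltac:(lia)).
  replace (S (pred M)) with M in H1 by lia.
  assert (H2 := transfer_bound (x M) (cell_gap (lam (pred M)) (x M) (x (pred M)))). lra. }
induction m as [|m IH]; intros Hm.
- rewrite !sum_n_n; assert (H1 := Hcell 0%nat Hm); simpl INR.
  assert (H2 := transfer_bound (x 0%nat) (cell_gap (lam 0%nat) (x 0%nat) (x 1%nat))). lra.
- rewrite !sum_n_Sm by lia; rewrite (S_INR (S m)).
  assert (H1 := IH ltac:(lia)); assert (H2 := Hcell (S m) Hm).
  replace (cell_gap (lam (S m)) (x (S m)) (x (S (S m)))) with (- cell_gap (lam m) (x (S m)) (x m)) in H2
    by (assert (H3 := Hb m Hm); lra).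
  rewrite transfer_opp in H2. change (@plus R_AbelianMonoid) with Rplus in *. lra.
Qed.

(** * Truncated powers *)

(** For [k = 0] this is the constant 1, not a step function; vanishing on the left needs an exponent
    of at least 1. *)
Definition tpow (k : nat) (z : R) : R := (Rmax 0 z)^k.

Lemma tpow_pos k z : 0 <= z -> tpow k z = z^k.
Proof. intros Hz; unfold tpow; now rewrite Rmax_right. Qed.

Lemma tpow_neg k z : z <= 0 -> tpow (S k) z = 0.
Proof. intros Hz; unfold tpow; rewrite Rmax_left by assumption; simpl; ring. Qed.

Lemma is_derive_tpow k z : is_derive (tpow (S (S k))) z (INR (S (S k)) * tpow (S k) z).
Proof.
destruct (Rtotal_order z 0) as [Hz|[->|Hz]].
- rewrite tpow_neg, Rmult_0_r by lra.
  apply (is_derive_ext_loc (fun _ => 0)); [|apply @is_derive_const].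
  apply (filter_imp (fun t => t < 0)); [|now apply open_lt].
  intros t Ht; rewrite tpow_neg; lra.
- rewrite tpow_neg, Rmult_0_r by lra.
  apply is_derive_Reals; intros eps Heps.
  exists (mkposreal (Rmin 1 eps) (Rmin_pos 1 eps Rlt_0_1 Heps)); intros h Hh0 Hh; simpl in Hh.
  rewrite Rplus_0_l, (tpow_neg _ 0), !Rminus_0_r by lra.
  destruct (Rle_dec h 0) as [Hh1|Hh1].
  + rewrite tpow_neg by lra. unfold Rdiv; rewrite Rmult_0_l, Rabs_R0; exact Heps.
  + rewrite tpow_pos by lra. rewrite Rabs_pos_eq in Hh by lra.
    assert (H1 := Rmin_l 1 eps); assert (H2 := Rmin_r 1 eps).
    replace (h^S (S k)/h) with (h*h^k) by (simpl; field; lra).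
    assert (0 <= h^k <= 1) by (split; [apply pow_le; lra|rewrite <- (pow1 k); apply pow_incr; lra]).
    rewrite Rabs_pos_eq by (apply Rmult_le_pos; lra). nra.
- rewrite tpow_pos by lra.
  apply (is_derive_ext_loc (fun t => t^S (S k))).
  + apply (filter_imp (fun t => 0 < t)); [|now apply open_gt].
    intros t Ht; rewrite tpow_pos; lra.
  + auto_derive; trivial. simpl; ring.
Qed.

Lemma is_derive_tpow_shift k y x :
  is_derive (fun x => tpow (S (S k)) (x - y)) x (INR (S (S k)) * tpow (S k) (x - y)).
Proof.
evar_last.
- apply (is_derive_comp (tpow (S (S k))) (fun x => x - y) x (INR (S (S k)) * tpow (S k) (x - y)) 1); [apply is_derive_tpow|].
  auto_derive; trivial; ring.
- apply Rmult_1_l.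
Qed.

Lemma continuous_tpow_shift k y x : continuous (fun x => tpow k (x - y)) x.
Proof.
unfold tpow.
apply (continuous_comp (fun x => Rmax 0 (x - y)) (fun z => z^k)).
- apply (continuous_ext (fun x => (x - y + Rabs (x - y))/2)).
  { intros t; match goal with |- ?a = ?b => change (@eq R a b) end.
    unfold Rmax; destruct (Rle_dec 0 (t-y)).
    - rewrite Rabs_pos_eq by lra; field.
    - rewrite Rabs_left by lra; field. }
  unfold Rdiv; apply (continuous_mult (K := R_AbsRing)); [|apply continuous_const].
  apply (continuous_plus (V := R_NormedModule)).
  + apply @ex_derive_continuous; auto_derive; trivial.
  + apply (continuous_comp (fun x => x - y) Rabs); [|apply continuous_Rabs].
    apply @ex_derive_continuous; auto_derive; trivial.
- apply @ex_derive_continuous; auto_derive; trivial.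
Qed.

Lemma is_RInt_tpow k y : 0 <= y ->
  is_RInt (fun x => tpow (S k) (x - y)) 0 1 (tpow (S (S k)) (1 - y) / INR (S (S k))).
Proof.
intros Hy.
assert (Hk : INR (S (S k)) <> 0) by (apply not_0_INR; lia).
evar_last.
- apply (is_RInt_derive (fun x => tpow (S (S k)) (x - y) / INR (S (S k))) (fun x => tpow (S k) (x - y))).
  + intros x _.
    apply (is_derive_ext (fun x => / INR (S (S k)) * tpow (S (S k)) (x - y))).
    { intros t; apply Rmult_comm. }
    replace (tpow (S k) (x - y)) with (/ INR (S (S k)) * (INR (S (S k)) * tpow (S k) (x - y))) by (field; exact Hk).
    apply is_derive_scal, is_derive_tpow_shift.
  + intros x _; apply continuous_tpow_shift.
- change (tpow (S (S k)) (1 - y) / INR (S (S k)) - tpow (S (S k)) (0 - y) / INR (S (S k))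
    = tpow (S (S k)) (1 - y) / INR (S (S k))).
  rewrite (tpow_neg _ (0-y)) by lra. unfold Rdiv; ring.
Qed.

Lemma Ck_on_4 (D : R -> Prop) (f f1 f2 f3 f4 : R -> R) :
  (forall x, is_derive f x (f1 x)) -> (forall x, is_derive f1 x (f2 x)) ->
  (forall x, is_derive f2 x (f3 x)) -> (forall x, is_derive f3 x (f4 x)) ->
  (forall x, continuous f4 x) -> Ck_on D 4 f f4.
Proof.
assert (HD : forall g g' : R -> R, (forall x, is_derive g x (g' x)) -> forall x, D x -> D_in g g' D x).
{ intros g g' H x _. apply (D_in_imp _ _ no_cond); [easy|].
  apply derivable_pt_lim_D_in, is_derive_Reals, H. }
intros H1 H2 H3 H4 H5.
exists f1; split; [now apply HD|]. exists f2; split; [now apply HD|].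
exists f3; split; [now apply HD|]. exists f4; split; [now apply HD|].
split; [|trivial]. intros x _.
assert (C : continuity_pt f4 x) by apply continuity_pt_filterlim, H5.
unfold continue_in; apply (limit1_imp _ (D_x no_cond x)); [|exact C].
intros t [_ Ht]; split; [exact I|exact Ht].
Qed.

(** * Peano kernels of negative definite rules *)

Lemma sum_n_m_comb (u v : nat -> R) (p q : R) (n m : nat) :
  sum_n_m (fun i => p * u i + q * v i) n m = p * sum_n_m u n m + q * sum_n_m v n m.
Proof.
rewrite <- (sum_n_m_mult_l (K := R_Ring) p), <- (sum_n_m_mult_l (K := R_Ring) q).
exact (sum_n_m_plus (G := R_AbelianMonoid) (fun i => p * u i) (fun i => q * v i) n m).
Qed.

Lemma sum_n_m_le_loc (u v : nat -> R) (n m : nat) :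
  (forall i, (n <= i <= m)%nat -> u i <= v i) -> sum_n_m u n m <= sum_n_m v n m.
Proof.
intros H; rewrite (sum_n_m_ext_loc u (fun i => Rmin (u i) (v i))).
- apply sum_n_m_le; intros i; apply Rmin_r.
- intros i Hi; now rewrite Rmin_left by now apply H.
Qed.

Section Formula.

Variables (N : nat) (a tau : nat -> R).
Hypothesis tau01 : forall i, (1 <= i <= N)%nat -> 0 <= tau i <= 1.

Definition rule (f : R -> R) : R := sum_n_m (fun i => a i * f (tau i)) 1 N.

Lemma rule_comb f g p q : rule (fun x => p * f x + q * g x) = p * rule f + q * rule g.
Proof.
unfold rule; rewrite <- sum_n_m_comb. apply sum_n_m_ext; intros i.
match goal with |- ?a = ?b => change (@eq R a b) end. ring.
Qed.

Lemma rule_ext f g : (forall x, 0 <= x <= 1 -> f x = g x) -> rule f = rule g.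
Proof.
intros H; apply sum_n_m_ext_loc; intros i Hi; rewrite H; trivial; now apply tau01.
Qed.

Lemma rule_abs_le f B : (forall x, 0 <= x <= 1 -> Rabs (f x) <= B) ->
  Rabs (rule f) <= B * sum_n_m (fun i => Rabs (a i)) 1 N.
Proof.
intros H; apply Rle_trans with (sum_n_m (fun i => Rabs (a i * f (tau i))) 1 N).
- apply (norm_sum_n_m (V := R_NormedModule)).
- rewrite <- (sum_n_m_mult_l (K := R_Ring)). change (@mult R_Ring) with Rmult.
  apply sum_n_m_le_loc; intros i Hi; rewrite Rabs_mult, Rmult_comm.
  apply Rmult_le_compat_r; [apply Rabs_pos|now apply H, tau01].
Qed.

(** The remainder of the function [tpow j] shifted by [y], so [kernel 3 / 6] is the Peano kernel
    [K]. Formally the derivative of [kernel (S j)] is [- INR (S j) * kernel j]: thus [kernel 2 / 2]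
    is [-K'], and [kernel 4 / 24] is the integral of [K] from [y] to 1. *)
Definition kernel (j : nat) (y : R) : R :=
  (1 - y)^S j / INR (S j) - rule (fun x => tpow j (x - y)).

Variables (Q : (R -> R) -> R) (c : R).
Hypothesis Qrule : forall f, Q f = rule f.
Hypothesis Qneg : negative_definite 4 Q c.

Lemma remainder_eq f I : is_RInt f 0 1 I -> remainder Q f = I - rule f.
Proof. intros H; unfold remainder; rewrite Qrule; f_equal; now apply is_RInt_unique. Qed.

Lemma kernel_remainder j y : 0 <= y <= 1 ->
  is_RInt (fun x => tpow (S j) (x - y)) 0 1 ((1 - y)^S (S j) / INR (S (S j))).
Proof.
intros Hy; rewrite <- (tpow_pos (S (S j)) (1 - y)) by lra. apply is_RInt_tpow; lra.
Qed.

Lemma is_RInt_pow01 j : is_RInt (fun x => x^j) 0 1 (/ INR (S j)).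
Proof.
assert (Hk : INR (S j) <> 0) by (apply not_0_INR; lia).
evar_last.
- apply (is_RInt_derive (fun x => x^S j / INR (S j)) (fun x => x^j)).
  + intros x _.
    apply (is_derive_ext (fun x => / INR (S j) * x^S j)).
    { intros t; apply Rmult_comm. }
    replace (x^j) with (/ INR (S j) * (INR (S j) * 1 * x^pred (S j))) by (simpl pred; field; exact Hk).
    apply is_derive_scal, (is_derive_pow (fun x => x)), @is_derive_id.
  + intros x _. apply @ex_derive_continuous; auto_derive; trivial.
- change (1^S j / INR (S j) - 0^S j / INR (S j) = / INR (S j)).
  rewrite pow1, pow_i by lia. field; exact Hk.
Qed.

Lemma rule_pow j : (j <= 3)%nat -> rule (fun x => x^j) = / INR (S j).
Proof.
intros Hj.
assert (HC : Ck_on unit_interval 4 (fun x => x^j) (fun _ => 0)).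
{ assert (E : j = 0%nat \/ j = 1%nat \/ j = 2%nat \/ j = 3%nat) by lia.
  destruct E as [->|[->|[->| ->]]].
  - apply (Ck_on_4 _ _ (fun _ => 0) (fun _ => 0) (fun _ => 0)); intros x;
      try apply continuous_const; auto_derive; trivial; simpl; ring.
  - apply (Ck_on_4 _ _ (fun _ => 1) (fun _ => 0) (fun _ => 0)); intros x;
      try apply continuous_const; auto_derive; trivial; simpl; ring.
  - apply (Ck_on_4 _ _ (fun x => 2*x) (fun _ => 2) (fun _ => 0)); intros x;
      try apply continuous_const; auto_derive; trivial; simpl; ring.
  - apply (Ck_on_4 _ _ (fun x => 3*x^2) (fun x => 6*x) (fun _ => 6)); intros x;
      try apply continuous_const; auto_derive; trivial; simpl; ring. }
destruct (proj2 Qneg _ _ HC) as [xi [_ E]].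
rewrite (remainder_eq _ _ (is_RInt_pow01 j)) in E. lra.
Qed.

Lemma rule_pow4 : c = /120 - /24 * rule (fun x => x^4).
Proof.
assert (HC : Ck_on unit_interval 4 (fun x => x^4) (fun _ => 24)).
{ apply (Ck_on_4 _ _ (fun x => 4*x^3) (fun x => 12*x^2) (fun x => 24*x)); intros x;
      try apply continuous_const; auto_derive; trivial; simpl; ring. }
destruct (proj2 Qneg _ _ HC) as [xi [_ E]].
rewrite (remainder_eq _ _ (is_RInt_pow01 4)) in E. simpl INR in E. lra.
Qed.

(** For [z >= e] the error is exactly [10*z*e^4], for [z <= -e] it is 0, and in between every term
    is of order [e^5]. *)
Lemma tpow5_second_difference z e : 0 < e <= 1 -> Rabs z <= 1 ->
  Rabs (tpow 5 (z+e) - 2*tpow 5 z + tpow 5 (z-e) - 20*e^2*tpow 3 z) <= 64*e^3.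
Proof.
intros He Hz; apply Rabs_le_between in Hz.
assert (He2 : 0 < e^2) by (apply pow_lt; lra). assert (He3 : 0 < e^3) by (apply pow_lt; lra).
destruct (Rle_dec z (-e)) as [H1|H1].
{ rewrite !tpow_neg by lra. rewrite Rabs_pos_eq; lra. }
destruct (Rle_dec e z) as [H2|H2].
{ rewrite !tpow_pos by lra.
  assert (Hze : 0 <= z*e <= 1) by (split; nra).
  replace (_ - _) with (10*(z*e)*e^3) by ring. rewrite Rabs_pos_eq; nra. }
assert (Hb : forall t k, -e <= t <= 2*e -> 0 <= tpow k t <= (2*e)^k).
{ intros t k Ht; unfold tpow; split; [apply pow_le, Rmax_l|apply pow_incr; split; [apply Rmax_l|]].
  apply Rmax_lub; lra. }
assert (Hb1 : forall t k, -e <= t <= e -> 0 <= tpow k t <= e^k).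
{ intros t k Ht; unfold tpow; split; [apply pow_le, Rmax_l|apply pow_incr; split; [apply Rmax_l|]].
  apply Rmax_lub; lra. }
assert (B1 := Hb (z+e) 5%nat ltac:(lra)). assert (B2 := Hb1 z 5%nat ltac:(lra)).
rewrite (tpow_neg _ (z-e)) by lra.
assert (B4 := Hb1 z 3%nat ltac:(lra)).
assert (e^5 <= e^3).
{ replace (e^5) with (e^3*e^2) by ring. rewrite <- (Rmult_1_r (e^3)) at 2.
  apply Rmult_le_compat_l; [lra|]. rewrite <- (pow1 2); apply pow_incr; lra. }
assert (0 <= 20*e^2*tpow 3 z <= 20*e^5).
{ replace (e^5) with (e^2*e^3) by ring.
  assert (0 <= e^2*tpow 3 z) by (apply Rmult_le_pos; lra).
  assert (e^2*tpow 3 z <= e^2*e^3) by (apply Rmult_le_compat_l; lra). lra. }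
apply Rabs_le. replace ((2*e)^5) with (32*e^5) in B1 by ring. lra.
Qed.

(** The cubic truncated power is not of class C^4, so definiteness is tested on a second difference
    of quintic ones, whose fourth derivative is 120 times a nonnegative hat function. Division by
    [e^2] and small [e] give the claim. *)
Lemma kernel_nonpos y : 0 < y < 1 -> kernel 3 y <= 0.
Proof.
intros Hy.
set (W := sum_n_m (fun i => Rabs (a i)) 1 N).
assert (Hstep : forall e, 0 < e -> e <= y -> e <= 1 - y -> 5 * kernel 3 y <= 16 * e * W).
{ intros e He Hey Hey'.
  set (g := fun k x => tpow k (x - (y - e)) - 2 * tpow k (x - y) + tpow k (x - (y + e))).
  assert (Hd : forall k x, is_derive (g (S (S k))) x (INR (S (S k)) * g (S k) x)).
  { intros k x; unfold g.
    rewrite Rmult_plus_distr_l, Rmult_minus_distr_l.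
    apply @is_derive_plus; [apply @is_derive_minus|]; try apply is_derive_tpow_shift.
    replace (INR (S (S k)) * (2 * tpow (S k) (x - y))) with (2 * (INR (S (S k)) * tpow (S k) (x - y))) by ring.
    apply is_derive_scal, is_derive_tpow_shift. }
  assert (Hds : forall p q k x, q = p * INR (S (S k)) ->
    is_derive (fun x => p * g (S (S k)) x) x (q * g (S k) x)).
  { intros p q k x ->; rewrite Rmult_assoc; apply is_derive_scal, Hd. }
  assert (HC : Ck_on unit_interval 4 (fun x => 1 * g 5%nat x) (fun x => 120 * g 1%nat x)).
  { apply (Ck_on_4 _ _ (fun x => 5 * g 4%nat x) (fun x => 20 * g 3%nat x) (fun x => 60 * g 2%nat x));
      intros x; try (apply Hds; simpl; ring).
    unfold g; apply (continuous_scal_r 120 (V := R_NormedModule)).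
    apply @continuous_plus; [apply @continuous_minus|]; try apply continuous_tpow_shift.
    apply (continuous_scal_r 2 (V := R_NormedModule)), continuous_tpow_shift. }
  destruct (proj2 Qneg _ _ HC) as [xi [_ E]].
  assert (Hg1 : 0 <= g 1%nat xi).
  { unfold g, tpow, Rmax; repeat destruct Rle_dec; simpl; lra. }
  set (I := ((1-y+e)^6 - 2*(1-y)^6 + (1-y-e)^6)/6).
  assert (HI : is_RInt (fun x => 1 * g 5%nat x) 0 1 I).
  { assert (H1 := kernel_remainder 4 (y-e) ltac:(lra)).
    assert (H2 := kernel_remainder 4 y ltac:(lra)).
    assert (H3 := kernel_remainder 4 (y+e) ltac:(lra)).
    assert (H4 := is_RInt_plus _ _ _ _ _ _ (is_RInt_minus _ _ _ _ _ _ H1 (is_RInt_scal _ _ _ 2 _ H2)) H3).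
    evar_last.
    - apply (is_RInt_ext _ _ _ _ _) with (2 := H4). intros x _.
      match goal with |- ?a = ?b => change (@eq R a b) end.
      unfold g, minus, plus, opp, scal; simpl; unfold mult; simpl. ring.
    - match goal with |- ?a = ?b => change (@eq R a b) end.
      unfold I, minus, plus, opp, scal; simpl; unfold mult; simpl. field. }
  rewrite (remainder_eq _ _ HI) in E.
  assert (HR : I <= rule (fun x => 1 * g 5%nat x)).
  { assert (c * (120 * g 1%nat xi) <= 0); [|lra]. destruct Qneg; nra. }
  set (t3 := fun x => tpow 3 (x - y)).
  assert (Herr : Rabs (rule (fun x => 1 * (1 * g 5%nat x) + (-20*e^2) * t3 x)) <= 64*e^3*W).
  { apply rule_abs_le; intros x Hx.
    replace (1 * (1 * g 5%nat x) + (-20*e^2) * t3 x) with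
      (tpow 5 (x-y+e) - 2*tpow 5 (x-y) + tpow 5 (x-y-e) - 20*e^2*tpow 3 (x-y)).
    - apply tpow5_second_difference; [lra|apply Rabs_le; lra].
    - unfold g, t3. replace (x-(y-e)) with (x-y+e) by ring. replace (x-(y+e)) with (x-y-e) by ring. ring. }
  rewrite rule_comb in Herr. apply Rabs_le_between in Herr.
  assert (HI5 : 5*e^2*(1-y)^4 <= I).
  { unfold I. replace (_/6) with (5*e^2*(1-y)^4 + (5*e^4*(1-y)^2 + e^6/3)) by field.
    assert (0 <= e^4*(1-y)^2) by (apply Rmult_le_pos; apply pow_le; lra).
    assert (0 <= e^6) by (apply pow_le; lra). lra. }
  unfold kernel. fold t3. simpl INR.
  apply (Rmult_le_reg_l (4*e^2)); [assert (0 < e^2) by (apply pow_lt, He); lra|].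
  replace ((1-y)^4/(1+1+1+1)) with ((1-y)^4/4) by field.
  replace (4*e^2*(16*e*W)) with (64*e^3*W) by ring. lra. }
apply Rnot_lt_le; intros HK.
assert (HW : 0 <= W).
{ unfold W. replace 0 with (sum_n_m (fun _ => 0) 1 N).
  - apply sum_n_m_le; intros i; apply Rabs_pos.
  - rewrite sum_n_m_const; apply Rmult_0_r. }
(* With this [e], a positive kernel value would satisfy [5 * kernel 3 y <= 16*e*W < 5 * kernel 3 y];
   the second bound keeps [y-e] and [y+e] in the unit interval. *)
set (e := Rmin (kernel 3 y/(4*(W+1))) (Rmin y (1-y))).
assert (He0 : 0 < kernel 3 y/(4*(W+1))) by (apply Rdiv_lt_0_compat; lra).
assert (He : 0 < e) by (repeat apply Rmin_pos; lra).
assert (He1 : e <= kernel 3 y/(4*(W+1))) by apply Rmin_l.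
assert (He2 : e <= Rmin y (1-y)) by apply Rmin_r.
assert (H1 := Rmin_l y (1-y)). assert (H2 := Rmin_r y (1-y)).
assert (H3 := Hstep e He ltac:(lra) ltac:(lra)).
assert (H4 : e*(4*(W+1)) <= kernel 3 y).
{ apply (Rmult_le_compat_r (4*(W+1))) in He1; [|lra].
  replace (kernel 3 y/(4*(W+1))*(4*(W+1))) with (kernel 3 y) in He1 by (field; lra). exact He1. }
lra.
Qed.

Lemma rule_ext_nodes f g : (forall i, (1 <= i <= N)%nat -> f (tau i) = g (tau i)) -> rule f = rule g.
Proof. intros H; apply sum_n_m_ext_loc; intros i Hi; now rewrite H. Qed.

Lemma rule_0 f : (forall i, (1 <= i <= N)%nat -> f (tau i) = 0) -> rule f = 0.
Proof.
intros H; rewrite (rule_ext_nodes f (fun x => 0 * f x + 0 * f x)).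
- rewrite rule_comb; ring.
- intros i Hi; rewrite H by assumption; ring.
Qed.

Lemma rule_comb5 f1 f2 f3 f4 f5 p1 p2 p3 p4 p5 :
  rule (fun x => p1 * f1 x + 1 * (p2 * f2 x + 1 * (p3 * f3 x + 1 * (p4 * f4 x + p5 * f5 x)))) =
  p1 * rule f1 + p2 * rule f2 + p3 * rule f3 + p4 * rule f4 + p5 * rule f5.
Proof.
rewrite (rule_comb f1 (fun x => p2 * f2 x + 1 * (p3 * f3 x + 1 * (p4 * f4 x + p5 * f5 x)))).
rewrite (rule_comb f2 (fun x => p3 * f3 x + 1 * (p4 * f4 x + p5 * f5 x))).
rewrite (rule_comb f3 (fun x => p4 * f4 x + p5 * f5 x)).
rewrite (rule_comb f4 f5). ring.
Qed.

Lemma kernel_at_0 j : kernel (S j) 0 = / INR (S (S j)) - rule (fun x => x^S j).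
Proof.
unfold kernel; rewrite Rminus_0_r, pow1; unfold Rdiv; rewrite Rmult_1_l; f_equal.
apply rule_ext; intros x Hx; rewrite Rminus_0_r; apply tpow_pos; lra.
Qed.

Lemma kernel_at_0_eq0 j : (j <= 2)%nat -> kernel (S j) 0 = 0.
Proof. intros Hj; rewrite kernel_at_0, rule_pow by lia; ring. Qed.

Lemma kernel4_at_0 : kernel 4 0 = 24 * c.
Proof. rewrite kernel_at_0, rule_pow4; simpl INR; field. Qed.

Lemma kernel_at_1 j : kernel (S j) 1 = 0.
Proof.
unfold kernel; rewrite rule_0.
- rewrite Rminus_diag, pow_i by lia. unfold Rdiv; ring.
- intros i Hi; apply tpow_neg. generalize (tau01 i Hi); lra.
Qed.

(** * Kernel identities on a cell and the upper bound for the error constant *)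

Hypothesis N_ge2 : (2 <= N)%nat.
Hypothesis tau_incr : forall i j, (1 <= i)%nat -> (i < j)%nat -> (j <= N)%nat -> tau i < tau j.

Lemma tau_le i j : (1 <= i)%nat -> (i <= j)%nat -> (j <= N)%nat -> tau i <= tau j.
Proof.
intros Hi Hij Hj; destruct (Nat.eq_dec i j) as [->|]; [lra|apply Rlt_le, tau_incr; lia].
Qed.

(** To the right of all nodes the kernel would be [(1-y)^4/4 > 0]. *)
Lemma tau_last : tau N = 1.
Proof.
assert (HN := tau01 N ltac:(lia)).
destruct (Rle_lt_or_eq_dec _ _ (proj2 HN)) as [H1|]; trivial; exfalso.
set (y := (1 + tau N)/2). assert (Hy : 0 < y < 1) by (unfold y; lra).
assert (HK := kernel_nonpos y Hy); unfold kernel in HK.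
rewrite rule_0 in HK.
- assert (0 < (1-y)^4) by (apply pow_lt; lra). simpl INR in HK; lra.
- intros i Hi; apply tpow_neg. generalize (tau_le i N ltac:(lia) ltac:(lia) ltac:(lia)). unfold y; lra.
Qed.

(** To the left of all nodes the truncation is inactive, so exactness on cubics would give the
    kernel the value [y^4/4 > 0]. *)
Lemma tau_first : tau 1%nat = 0.
Proof.
assert (HN := tau01 1%nat ltac:(lia)).
destruct (Rle_lt_or_eq_dec _ _ (proj1 HN)) as [H1|]; [exfalso|symmetry; trivial].
set (y := tau 1%nat/2). assert (Hy : 0 < y < 1) by (unfold y; lra).
assert (HK := kernel_nonpos y Hy); unfold kernel in HK.
rewrite (rule_ext_nodes _ (fun x => 1*x^3 + 1*((-3*y)*x^2 + 1*((3*y^2)*x^1 + 1*((-y^3)*x^0 + 0*x^0))))) in HK.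
- rewrite (rule_comb5 (fun x => x^3) (fun x => x^2) (fun x => x^1) (fun x => x^0) (fun x => x^0)) in HK.
  rewrite !rule_pow in HK by lia. simpl INR in HK.
  assert (0 < y^4) by (apply pow_lt; lra). lra.
- intros i Hi; rewrite tpow_pos; [ring|].
  generalize (tau_le 1 i ltac:(lia) ltac:(lia) ltac:(lia)). unfold y; lra.
Qed.

Lemma node_outside j i : (1 <= j < N)%nat -> (1 <= i <= N)%nat -> tau i <= tau j \/ tau (S j) <= tau i.
Proof.
intros Hj Hi; destruct (Nat.le_gt_cases i j); [left|right]; apply tau_le; lia.
Qed.

(** The corrected trapezoidal rule, exact up to the term from [K'''' = 1]. The combination of
    truncated powers involved vanishes outside the open cell, hence at every node. *)
Lemma kernel4_cell j (l := tau (S j) - tau j) : (1 <= j < N)%nat ->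
  kernel 4 (tau j) - kernel 4 (tau (S j)) =
  2*l*(kernel 3 (tau j) + kernel 3 (tau (S j)))
  - l^2*(kernel 2 (tau j) - kernel 2 (tau (S j))) + l^5/30.
Proof.
intros Hj; assert (Hinc := tau_incr j (S j) ltac:(lia) ltac:(lia) ltac:(lia)).
assert (HR : rule (fun x => tpow 4 (x - tau j) + -1*tpow 4 (x - tau (S j)) - 2*l*tpow 3 (x - tau j)
   - 2*l*tpow 3 (x - tau (S j)) + l^2*(tpow 2 (x - tau j) - tpow 2 (x - tau (S j)))) = 0).
{ apply rule_0; intros i Hi; destruct (node_outside j i Hj Hi).
  - rewrite !tpow_neg by lra; ring.
  - rewrite !tpow_pos by lra; unfold l; ring. }
rewrite (rule_ext _ (fun x => 1*(1*tpow 4 (x - tau j) + -1*tpow 4 (x - tau (S j)))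
   + 1*(-2*l*tpow 3 (x - tau j) + 1*(-2*l*tpow 3 (x - tau (S j)) + 1*(l^2*tpow 2 (x - tau j) + -l^2*tpow 2 (x - tau (S j))))))) in HR
  by (intros; ring).
rewrite (rule_comb5 (fun x => 1*tpow 4 (x - tau j) + -1*tpow 4 (x - tau (S j))) (fun x => tpow 3 (x - tau j))
  (fun x => tpow 3 (x - tau (S j))) (fun x => tpow 2 (x - tau j)) (fun x => tpow 2 (x - tau (S j)))) in HR.
rewrite (rule_comb (fun x => tpow 4 (x - tau j)) (fun x => tpow 4 (x - tau (S j)))) in HR.
unfold kernel; simpl INR; unfold l in *. lra.
Qed.

(** Cubic Hermite interpolation with its remainder for a quartic, again because the matching
    combination of truncated powers vanishes at every node. *)
Lemma kernel3_cell j th (l := tau (S j) - tau j) : (1 <= j < N)%nat -> 0 <= th <= 1 ->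
  kernel 3 (tau j + th*l) =
  (1+2*th)*(1-th)^2*kernel 3 (tau j) - 3*l*th*(1-th)^2*kernel 2 (tau j)
  + th^2*(3-2*th)*kernel 3 (tau (S j)) + 3*l*th^2*(1-th)*kernel 2 (tau (S j))
  + l^4*th^2*(1-th)^2/4.
Proof.
intros Hj Hth; assert (Hinc := tau_incr j (S j) ltac:(lia) ltac:(lia) ltac:(lia)).
assert (Hin : tau j <= tau j + th*l <= tau (S j)) by (unfold l; nra).
assert (HR : rule (fun x => 1*tpow 3 (x - (tau j + th*l))
   + 1*(-((1+2*th)*(1-th)^2)*tpow 3 (x - tau j) + 1*(-(th^2*(3-2*th))*tpow 3 (x - tau (S j))
   + 1*(3*l*th*(1-th)^2*tpow 2 (x - tau j) + -(3*l*th^2*(1-th))*tpow 2 (x - tau (S j)))))) = 0).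
{ apply rule_0; intros i Hi; destruct (node_outside j i Hj Hi).
  - rewrite !tpow_neg by lra; ring.
  - rewrite !tpow_pos by lra; unfold l; ring. }
rewrite (rule_comb5 (fun x => tpow 3 (x - (tau j + th*l))) (fun x => tpow 3 (x - tau j))
  (fun x => tpow 3 (x - tau (S j))) (fun x => tpow 2 (x - tau j)) (fun x => tpow 2 (x - tau (S j)))) in HR.
unfold kernel; simpl INR; unfold l in *. lra.
Qed.

(* [E0], [E1] stand for [- K'] at the ends of the cell; the expression multiplied by [w] is [K] at the
   point dividing the cell in the ratio [th]. *)
Lemma hermite_combination l A0 A1 K0 K1 E0 E1 (th := A1/(A0+A1)) (w := (A0+A1)^3/(l*A0*A1)) :
  0 < l -> 0 < A0 -> 0 < A1 ->
  l/2*(K0+K1) - l^2/12*(E0-E1) + l^5/720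
  - w*((1+2*th)*(1-th)^2*K0 - l*th*(1-th)^2*E0 + th^2*(3-2*th)*K1 + l*th^2*(1-th)*E1
       + l^4*th^2*(1-th)^2/24) =
  K0*(l/2 - A0*(A0+3*A1)/(l*A1)) + K1*(l/2 - A1*(A1+3*A0)/(l*A0))
  + (A0-l^2/12)*E0 - (A1-l^2/12)*E1 - (l^3*A0*A1/(24*(A0+A1)) - l^5/720).
Proof. intros; unfold w, th; field; lra. Qed.

(** The left side is the integral of [K] over the cell. Subtracting [w] times the nonpositive value
    of [K] at one point can only increase it, and [hermite_combination] evaluates the result. *)
Lemma kernel_cell_bound j lam x0 x1 (h := / INR N) : (1 <= j < N)%nat ->
  tau (S j) - tau j = h*lam -> 0 < x0 -> 0 < x1 ->
  (kernel 4 (tau j) - kernel 4 (tau (S j)))/24 <=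
  - h/24*(cell_gap lam x0 x1*(kernel 3 (tau j)/6) + cell_gap lam x1 x0*(kernel 3 (tau (S j))/6))
  + h^2*x0/24*(kernel 2 (tau j)/2) - h^2*x1/24*(kernel 2 (tau (S j))/2)
  - h^5/5760*cell_gain lam x0 x1.
Proof.
intros Hj Hl Hx0 Hx1.
assert (Hinc := tau_incr j (S j) ltac:(lia) ltac:(lia) ltac:(lia)).
assert (Hh : 0 < h) by (apply Rinv_0_lt_compat, lt_0_INR; lia).
assert (Hlam : 0 < lam).
{ apply (Rmult_lt_reg_l h); [exact Hh|lra]. }
assert (Hlam2 : 0 < lam^2) by (apply pow_lt, Hlam).
assert (Hh2 : 0 < h^2) by (apply pow_lt, Hh).
set (l := h*lam). assert (Hl0 : 0 < l) by (apply Rmult_lt_0_compat; lra).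
(* These are [l^2/12 + h^2*x/24]: the part [l^2/12] cancels the derivative terms of the trapezoidal
   rule, leaving the prescribed coefficients [h^2*x/24]. *)
set (A0 := h^2*(2*lam^2+x0)/24). set (A1 := h^2*(2*lam^2+x1)/24).
assert (HA0 : 0 < A0).
{ unfold A0; assert (0 < h^2*(2*lam^2+x0)) by (apply Rmult_lt_0_compat; lra). lra. }
assert (HA1 : 0 < A1).
{ unfold A1; assert (0 < h^2*(2*lam^2+x1)) by (apply Rmult_lt_0_compat; lra). lra. }
set (th := A1/(A0+A1)).
assert (Hth : 0 < th < 1).
{ unfold th; split; [apply Rdiv_lt_0_compat; lra|].
  apply (Rmult_lt_reg_r (A0+A1)); [lra|]. unfold Rdiv; rewrite Rmult_assoc, Rinv_l; lra. }
assert (HK : kernel 3 (tau j + th*l) <= 0).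
{ apply kernel_nonpos.
  assert (0 < th*l) by (apply Rmult_lt_0_compat; lra).
  assert (th*l < 1*l) by (apply Rmult_lt_compat_r; lra).
  assert (tau (S j) = tau j + l) by (unfold l; lra).
  generalize (tau01 j ltac:(lia)) (tau01 (S j) ltac:(lia)); lra. }
assert (H3 := kernel3_cell j th Hj ltac:(lra)).
assert (H4 := kernel4_cell j Hj).
rewrite Hl in H3, H4; fold l in H3, H4.
(* This weight at the ratio [th] solves [w*l*th*(1-th)^2 = A0] and [w*l*th^2*(1-th) = A1]. *)
set (w := (A0+A1)^3/(l*A0*A1)).
assert (Hw : 0 < w).
{ apply Rdiv_lt_0_compat; [apply pow_lt; lra|repeat apply Rmult_lt_0_compat; lra]. }
assert (HC := hermite_combination l A0 A1 (kernel 3 (tau j)/6) (kernel 3 (tau (S j))/6)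
  (kernel 2 (tau j)/2) (kernel 2 (tau (S j))/2) Hl0 HA0 HA1).
fold th w in HC.
assert (Hwk : 0 <= - (w * (kernel 3 (tau j + th*l)/6))) by nra.
rewrite H3 in Hwk.
set (K0 := kernel 3 (tau j)) in *. set (K1 := kernel 3 (tau (S j))) in *.
set (E0 := kernel 2 (tau j)) in *. set (E1 := kernel 2 (tau (S j))) in *.
apply Rle_trans with (K0/6*(l/2 - A0*(A0+3*A1)/(l*A1)) + K1/6*(l/2 - A1*(A1+3*A0)/(l*A0))
  + (A0-l^2/12)*(E0/2) - (A1-l^2/12)*(E1/2) - (l^3*A0*A1/(24*(A0+A1)) - l^5/720)).
- rewrite <- HC, H4. clear - Hwk.
  match type of Hwk with 0 <= - (w * (?t / 6)) => set (T := t) in * end.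
  match goal with |- _ <= _ - w * ?t => replace t with (T/6) by (unfold T; field) end.
  lra.
- right. unfold cell_gap, cell_gain, A0, A1, l.
  field. repeat split; try lra; nra.
Qed.

(** The cell bounds are summed with balanced potentials for the scaled cell lengths. Potential [i]
    belongs to node [tau (S i)], so there are [pred N] cells. *)
Lemma negative_definite_upper_bound : c <= - (7 / (5760 * INR N^4)).
Proof.
assert (HN : 2 <= INR N) by (apply (le_INR 2); lia).
set (h := / INR N). assert (Hh : 0 < h) by (apply Rinv_0_lt_compat; lra).
set (lam := fun i => INR N*(tau (S (S i)) - tau (S i))).
assert (Hlam : forall i, (i < pred N)%nat -> 0 < lam i).
{ intros i Hi; apply Rmult_lt_0_compat; [lra|].
  generalize (tau_incr (S i) (S (S i)) ltac:(lia) ltac:(lia) ltac:(lia)); lra. }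
destruct (balanced_potentials_exist (pred N) lam ltac:(lia) Hlam) as (x & Hx & Hb).
assert (HG := balanced_gain (pred N) lam x ltac:(lia) Hlam Hx Hb).
assert (Hsum : forall m, sum_n_m lam 0 m = INR N*(tau (S (S m)) - tau 1%nat)).
{ induction m as [|m IH]; [now rewrite sum_n_n|].
  rewrite sum_n_Sm by lia; rewrite IH; unfold lam.
  match goal with |- plus ?a ?b = ?d => change (a + b = d) end. ring. }
assert (Hcell : forall i, (i < pred N)%nat -> _) by exact (fun i Hi =>
  kernel_cell_bound (S i) (lam i) (x i) (x (S i)) ltac:(lia)
   ltac:(unfold lam; field; lra) (Hx i ltac:(lia)) (Hx (S i) ltac:(lia))).
fold h in Hcell.
(* After [m+1] cells only boundary terms at the right end are left: inner derivative terms
   telescope, inner kernel values cancel by balance, and both vanish at the node 0 by exactness on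
   cubics. *)
assert (Hacc : forall m, (m < pred N)%nat ->
  (kernel 4 (tau 1%nat) - kernel 4 (tau (S (S m))))/24 <=
  - h/24*(cell_gap (lam m) (x (S m)) (x m)*(kernel 3 (tau (S (S m)))/6))
  - h^2*x (S m)/24*(kernel 2 (tau (S (S m)))/2)
  - h^5/5760*sum_n_m (fun i => cell_gain (lam i) (x i) (x (S i))) 0 m).
{ induction m as [|m IH]; intros Hm.
  - rewrite sum_n_n. assert (H := Hcell 0%nat Hm).
    assert (K0 : forall k, (k <= 2)%nat -> kernel (S k) (tau 1%nat) = 0).
    { intros k Hk; rewrite tau_first; now apply kernel_at_0_eq0. }
    rewrite (K0 2%nat), (K0 1%nat) in H by lia. lra.
  - rewrite sum_n_Sm by lia. change (@plus R_AbelianMonoid) with Rplus.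
    assert (H := Hcell (S m) Hm). assert (H' := IH ltac:(lia)).
    replace (cell_gap (lam (S m)) (x (S m)) (x (S (S m)))) with (- cell_gap (lam m) (x (S m)) (x m)) in H
      by (generalize (Hb m Hm); lra).
    lra. }
assert (H := Hacc (pred (pred N)) ltac:(lia)).
replace (S (S (pred (pred N)))) with N in H by lia.
rewrite tau_last, !kernel_at_1, tau_first, kernel4_at_0 in H.
rewrite Hsum in HG. replace (S (S (pred (pred N)))) with N in HG by lia.
rewrite tau_last, tau_first in HG.
replace (INR (pred N)) with (INR N - 1) in HG by (rewrite <- (Nat.succ_pred_pos N) at 1 by lia; rewrite S_INR; lra).
set (G := sum_n_m _ _ _) in *.
assert (H5 : 0 < h^5) by (apply pow_lt, Hh).
replace (7/(5760*INR N^4)) with (h^5/5760*(7*INR N)) by (unfold h; field; lra).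
(* The scaled lengths add up to [INR N], so [G >= 35*N - 28*(N-1) - 21/2 >= 7*N]. *)
assert (h^5/5760*(7*INR N) <= h^5/5760*G) by (apply Rmult_le_compat_l; lra).
lra.
Qed.
End Formula.

(** * Sign of the remainder of the midpoint-type rule *)

(** Composition with this retraction extends a function continuous on the unit interval to a
    continuous function on the line. *)
Definition clamp01 (x : R) : R := Rmax 0 (Rmin x 1).

Lemma clamp01_id x : 0 <= x <= 1 -> clamp01 x = x.
Proof. intros Hx; unfold clamp01; rewrite Rmin_left, Rmax_right; lra. Qed.

Lemma clamp01_bounds x : 0 <= clamp01 x <= 1.
Proof. unfold clamp01, Rmax, Rmin; repeat destruct Rle_dec; lra. Qed.

Lemma clamp01_contract x y : Rabs (clamp01 x - clamp01 y) <= Rabs (x - y).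
Proof.
unfold clamp01, Rmax, Rmin, Rabs; repeat destruct Rle_dec; repeat destruct Rcase_abs; lra.
Qed.

Lemma continuous_clamp01 (g : R -> R) : (forall x, 0 <= x <= 1 -> continue_in g unit_interval x) ->
  forall x, continuous (fun x => g (clamp01 x)) x.
Proof.
intros H x; apply continuity_pt_filterlim; intros eps Heps.
destruct (H (clamp01 x) (clamp01_bounds x) eps Heps) as [d [Hd Hg]].
exists d; split; [exact Hd|]; intros t [_ Ht]; simpl in *; unfold Rdist in *.
destruct (Req_dec (clamp01 t) (clamp01 x)) as [->|Hne].
- rewrite Rminus_diag, Rabs_R0; exact Heps.
- apply Hg; split; [split; [apply clamp01_bounds|auto]|].
  apply Rle_lt_trans with (2 := Ht), clamp01_contract.
Qed.

Lemma is_derive_clamp01 (g g' : R -> R) x : D_in g g' unit_interval x -> 0 < x < 1 ->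
  is_derive (fun x => g (clamp01 x)) x (g' (clamp01 x)).
Proof.
intros H Hx; rewrite (clamp01_id x) by lra.
assert (Hin : locally x (fun t => 0 < t < 1)).
{ apply filter_and; [apply (open_gt 0 x)|apply (open_lt 1 x)]; lra. }
apply (is_derive_ext_loc g).
{ apply (filter_imp _ _ (fun t Ht => eq_sym (f_equal g (clamp01_id t (conj (Rlt_le _ _ (proj1 Ht)) (Rlt_le _ _ (proj2 Ht))))))).
  exact Hin. }
apply is_derive_Reals, derivable_pt_lim_D_in.
intros eps Heps; destruct (H eps Heps) as [d [Hd Hg]].
destruct Hin as [r Hr].
exists (Rmin d r); split; [apply Rmin_pos; [exact Hd|apply cond_pos]|].
intros t [[_ Ht1] Ht2]; simpl in *. apply Hg; split.
- split; [|exact Ht1]. assert (0 < t < 1); [|split; lra].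
  apply Hr. apply Rlt_le_trans with (1 := Ht2), Rmin_r.
- apply Rlt_le_trans with (1 := Ht2), Rmin_l.
Qed.

Section Pieces.

Variables f f1 f2 f3 f4 : R -> R.
Hypotheses (Cf : forall x, continuous f x) (Cf1 : forall x, continuous f1 x)
  (Cf2 : forall x, continuous f2 x) (Cf3 : forall x, continuous f3 x).
Hypotheses (Df : forall x, 0 < x < 1 -> is_derive f x (f1 x))
  (Df1 : forall x, 0 < x < 1 -> is_derive f1 x (f2 x))
  (Df2 : forall x, 0 < x < 1 -> is_derive f2 x (f3 x))
  (Df3 : forall x, 0 < x < 1 -> is_derive f3 x (f4 x)).
Hypothesis f4_ge0 : forall x, 0 <= x <= 1 -> 0 <= f4 x.

(** A kernel piece in Taylor form at [e]: [A], [B], [C], [D] are [K'''], [K''], [K'], [K] there, and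
    the coefficient [1/24] expresses [K'''' = 1]. *)
Definition quartic (e A B C D x : R) : R :=
  (x-e)^4/24 + A*(x-e)^3/6 + B*(x-e)^2/2 + C*(x-e) + D.

Definition bracket (e A B C D x : R) : R :=
  quartic e A B C D x * f3 x - ((x-e)^3/6 + A*(x-e)^2/2 + B*(x-e) + C) * f2 x
  + ((x-e)^2/2 + A*(x-e) + B) * f1 x - ((x-e) + A) * f x + RInt f 0 x.

Lemma is_derive_RInt_0 x : is_derive (fun x => RInt f 0 x) x (f x).
Proof.
apply (is_derive_RInt f (fun x => RInt f 0 x) 0); [|apply Cf].
apply filter_forall; intros t. apply (RInt_correct (V := R_CompleteNormedModule)).
apply (ex_RInt_continuous (V := R_CompleteNormedModule)); intros; apply Cf.
Qed.

Lemma is_derive_bracket e A B C D x : 0 < x < 1 ->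
  is_derive (bracket e A B C D) x (quartic e A B C D x * f4 x).
Proof.
intros Hx.
assert (E0 := Df x Hx). assert (E1 := Df1 x Hx). assert (E2 := Df2 x Hx). assert (E3 := Df3 x Hx).
assert (HG : forall G : R -> R, is_derive G x (f x) -> is_derive (fun x =>
  ((x-e)^4/24 + A*(x-e)^3/6 + B*(x-e)^2/2 + C*(x-e) + D) * f3 x
  - ((x-e)^3/6 + A*(x-e)^2/2 + B*(x-e) + C) * f2 x
  + ((x-e)^2/2 + A*(x-e) + B) * f1 x - ((x-e) + A) * f x + G x) x (quartic e A B C D x * f4 x)).
{ intros G EG; unfold quartic. auto_derive.
  - repeat split; eexists; eassumption.
  - change (fun x => f3 x) with f3. change (fun x => f2 x) with f2.
    change (fun x => f1 x) with f1. change (fun x => f x) with f. change (fun x => G x) with G.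
    rewrite (is_derive_unique _ _ _ E0), (is_derive_unique _ _ _ E1), (is_derive_unique _ _ _ E2),
     (is_derive_unique _ _ _ E3), (is_derive_unique _ _ _ EG). field. }
exact (HG _ (is_derive_RInt_0 x)).
Qed.

Lemma continuous_bracket e A B C D x : continuous (bracket e A B C D) x.
Proof.
assert (Cp : forall p : R -> R, ex_derive p x -> continuous p x).
{ intros p; apply @ex_derive_continuous. }
assert (CM : forall u v : R -> R, continuous u x -> continuous v x -> continuous (fun x => u x * v x) x).
{ intros u v; apply (continuous_mult (K := R_AbsRing)). }
assert (CP : forall u v : R -> R, continuous u x -> continuous v x -> continuous (fun x => u x + v x) x).
{ intros u v; apply (continuous_plus (V := R_NormedModule)). }
assert (CMi : forall u v : R -> R, continuous u x -> continuous v x -> continuous (fun x => u x - v x) x).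
{ intros u v; apply (continuous_minus (V := R_NormedModule)). }
unfold bracket, quartic.
apply CP; [apply CMi; [apply CP; [apply CMi|]|]|]; try (apply CM; trivial; apply Cp; auto_derive; trivial).
apply Cp; eexists; apply is_derive_RInt_0.
Qed.

Lemma bracket_decr e A B C D a b : 0 <= a -> a <= b -> b <= 1 ->
  (forall x, a <= x <= b -> quartic e A B C D x <= 0) ->
  bracket e A B C D b <= bracket e A B C D a.
Proof.
intros Ha Hab Hb Hq.
destruct (MVT_gen (bracket e A B C D) a b (fun x => quartic e A B C D x * f4 x)) as [t [Ht E]].
- rewrite Rmin_left, Rmax_right by lra; intros x Hx; apply is_derive_bracket; lra.
- intros x _; apply continuity_pt_filterlim, continuous_bracket.
- rewrite Rmin_left, Rmax_right in Ht by lra.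
  assert (H1 := Hq t Ht). assert (H2 := f4_ge0 t ltac:(lra)).
  assert (0 <= (- quartic e A B C D t) * f4 t * (b-a)) by (repeat apply Rmult_le_pos; lra).
  lra.
Qed.

(* Passing a node adds [- w (x - t)^3/6] to the kernel, which changes only its third derivative at [t]. *)
Lemma bracket_jump e A B C D e' A' B' C' D' t w :
  quartic e A B C D t = quartic e' A' B' C' D' t ->
  (t-e)^3/6 + A*(t-e)^2/2 + B*(t-e) + C = (t-e')^3/6 + A'*(t-e')^2/2 + B'*(t-e') + C' ->
  (t-e)^2/2 + A*(t-e) + B = (t-e')^2/2 + A'*(t-e') + B' ->
  (t-e) + A = (t-e') + A' + w ->
  bracket e' A' B' C' D' t = bracket e A B C D t + w * f t.
Proof. intros H1 H2 H3 H4; unfold bracket; rewrite H1, H2, H3, H4; ring. Qed.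

Variable n : nat.
Hypothesis n_ge1 : (1 <= n)%nat.
Let h := / INR n.

Lemma h_gt0 : 0 < h.
Proof. apply Rinv_0_lt_compat, lt_0_INR; lia. Qed.

(* The kernel near a boundary node, in the variable [u] = (distance to the boundary) / h. *)
Lemma kernel_pieces_nonpos u :
  (0 <= u <= 1/12 -> u^4 - 11/3*u^3 <= 0) /\
  (1/12 <= u <= 1/6 -> u^4 + 7/3*u^3 - 3/2*u^2 + u/8 - 1/288 <= 0) /\
  (1/6 <= u <= 1/4 -> u^4 - 2/3*u^3 - u/8 + 1/96 <= 0) /\
  (-1/2 <= u <= 1/2 -> u^4 - 1/2*u^2 <= 0).
Proof.
repeat split; intros Hu.
- assert (0 <= u^3) by (apply pow_le; lra). nra.
- assert (u^3 <= u^2/6) by (simpl; nra). assert (u^4 <= u^2/36) by (simpl; nra). nra.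
- assert (0 <= u^3) by (apply pow_le; lra). assert (u^4 <= u^3/4) by (simpl in *; nra). nra.
- assert (u^2 <= 1/4) by nra. replace (u^4) with (u^2*u^2) by ring. nra.
Qed.

Lemma quartic_nonpos e A B C D x (p : R -> R) (u := (x - e)/h) :
  (forall z, quartic e A B C D (e + h*z) = h^4/24 * p z) -> p u <= 0 -> quartic e A B C D x <= 0.
Proof.
intros Hp Hu; assert (Hh := h_gt0).
replace x with (e + h*u) by (unfold u; field; lra).
rewrite Hp. assert (0 < h^4) by (apply pow_lt, Hh). nra.
Qed.

(** The bracket is followed from 0 to 1: it starts at the weighted value at 0, decreases on each
    piece, gains weight times value at each node, and ends at the integral minus the weighted value
    at 1. *)
Lemma Qmid_bracket : RInt f 0 1 <= Qmid n f.
Proof.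
assert (Hh := h_gt0).
assert (Hn : 1 <= INR n) by (apply (le_INR 1); exact n_ge1).
assert (Hnh : INR n * h = 1) by (unfold h; field; lra).
assert (Hh1 : h <= 1) by nra.
assert (Hu : forall x e a b, e + h*a <= x <= e + h*b -> a <= (x-e)/h <= b).
{ intros x e a b Hx; split; apply (Rmult_le_reg_r h); trivial; unfold Rdiv;
    rewrite Rmult_assoc, Rinv_l, Rmult_1_r by lra; lra. }
assert (S0 : bracket 0 (-11*h/12) 0 0 0 0 = 11*h/12*f 0).
{ unfold bracket, quartic. rewrite RInt_point. change (@zero R_CompleteNormedModule) with 0. field. }
assert (S1 := bracket_decr 0 (-11*h/12) 0 0 0 0 (h/12) ltac:(lra) ltac:(lra) ltac:(lra)
  ltac:(intros x Hx; apply (quartic_nonpos _ _ _ _ _ _ (fun u => u^4 - 11/3*u^3));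
    [intros; unfold quartic; field|apply (kernel_pieces_nonpos _), Hu; lra])).
assert (J1 := bracket_jump 0 (-11*h/12) 0 0 0 0 (7*h/12) (-h^2/8) (h^3/192) (-h^4/6912) (h/12) (-3*h/2)
  ltac:(unfold quartic; field) ltac:(field) ltac:(field) ltac:(field)).
assert (S2 := bracket_decr 0 (7*h/12) (-h^2/8) (h^3/192) (-h^4/6912) (h/12) (h/6) ltac:(lra) ltac:(lra) ltac:(lra)
  ltac:(intros x Hx; apply (quartic_nonpos _ _ _ _ _ _ (fun u => u^4 + 7/3*u^3 - 3/2*u^2 + u/8 - 1/288));
    [intros; unfold quartic; field|apply (kernel_pieces_nonpos _), Hu; lra])).
assert (J2 := bracket_jump 0 (7*h/12) (-h^2/8) (h^3/192) (-h^4/6912) 0 (-h/6) 0 (-h^3/192) (h^4/2304) (h/6) (3*h/4)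
  ltac:(unfold quartic; field) ltac:(field) ltac:(field) ltac:(field)).
assert (S3 := bracket_decr 0 (-h/6) 0 (-h^3/192) (h^4/2304) (h/6) (h/4) ltac:(lra) ltac:(lra) ltac:(lra)
  ltac:(intros x Hx; apply (quartic_nonpos _ _ _ _ _ _ (fun u => u^4 - 2/3*u^3 - u/8 + 1/96));
    [intros; unfold quartic; field|apply (kernel_pieces_nonpos _), Hu; lra])).
assert (J3 := bracket_jump 0 (-h/6) 0 (-h^3/192) (h^4/2304) 0 0 (-h^2/24) 0 0 (h/4) (-h/6)
  ltac:(unfold quartic; field) ltac:(field) ltac:(field) ltac:(field)).
assert (Smid : forall e a b, 0 <= a -> a <= b -> b <= 1 -> e - h/2 <= a -> b <= e + h/2 ->
  bracket e 0 (-h^2/24) 0 0 b <= bracket e 0 (-h^2/24) 0 0 a).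
(* In the middle, every piece is the same even quartic about the nearest multiple [e] of [h]. *)
{ intros e a b Ha Hab Hb Hae Hbe; apply bracket_decr; trivial; intros x Hx.
  apply (quartic_nonpos _ _ _ _ _ _ (fun u => u^4 - 1/2*u^2));
    [intros; unfold quartic; field|apply (kernel_pieces_nonpos _), Hu; lra]. }
assert (Jmid : forall k, bracket (INR (S k)*h) 0 (-h^2/24) 0 0 (INR k*h + h/2) =
  bracket (INR k*h) 0 (-h^2/24) 0 0 (INR k*h + h/2) + h * f ((2*INR (S k) - 1)/(2*INR n))).
{ intros k; replace ((2*INR (S k) - 1)/(2*INR n)) with (INR k*h + h/2)
    by (rewrite S_INR; unfold h; field; lra).
  rewrite S_INR; apply bracket_jump; unfold quartic; field. }
set (left_sum := 11*h/12*f 0 - 3*h/2*f (h/12) + 3*h/4*f (h/6) - h/6*f (h/4)).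
(* The bracket just before the midpoint node [k+1] is at most the weighted sum over all earlier
   nodes. *)
assert (Hmid : forall k, (k < n)%nat -> bracket (INR k*h) 0 (-h^2/24) 0 0 (INR k*h + h/2) <=
  left_sum + h * sum_n_m (fun i => f ((2*INR i - 1)/(2*INR n))) 1 k).
{ induction k as [|k IH]; intros Hk.
  - rewrite sum_n_m_zero by lia. change (@zero R_AbelianMonoid) with 0.
    simpl INR. rewrite !Rmult_0_l, Rplus_0_l, Rmult_0_r.
    assert (S4 := Smid 0 (h/4) (h/2) ltac:(lra) ltac:(lra) ltac:(lra) ltac:(lra) ltac:(lra)).
    unfold left_sum; lra.
  - rewrite sum_n_Sm by lia. change (@plus R_AbelianMonoid) with Rplus.
    assert (H1 := IH ltac:(lia)). assert (H2 := Jmid k).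
    assert (Hk2 : INR (S k) + 1 <= INR n) by (rewrite <- S_INR; apply le_INR; lia).
    assert (H0 := pos_INR k).
    assert (H3 := Smid (INR (S k)*h) (INR k*h+h/2) (INR (S k)*h+h/2)).
    rewrite S_INR in *.
    assert (0 <= INR k*h) by (apply Rmult_le_pos; lra).
    assert ((INR k + 1 + 1)*h <= INR n*h) by (apply Rmult_le_compat_r; lra).
    specialize (H3 ltac:(lra) ltac:(lra) ltac:(lra) ltac:(lra) ltac:(lra)). lra. }
assert (HL := Hmid (pred n) ltac:(lia)). assert (HJ := Jmid (pred n)).
assert (Hp : INR (S (pred n)) * h = 1) by (replace (S (pred n)) with n by lia; exact Hnh).
assert (Hp' : INR (pred n)*h + h/2 = 1 - h/2) by (rewrite S_INR in Hp; lra).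
rewrite Hp, Hp' in HJ. rewrite Hp' in HL.
assert (Hsum : sum_n_m (fun i => f ((2*INR i - 1)/(2*INR n))) 1 n =
  sum_n_m (fun i => f ((2*INR i - 1)/(2*INR n))) 1 (pred n) + f ((2*INR (S (pred n)) - 1)/(2*INR n))).
{ replace n with (S (pred n)) at 1 by lia.
  exact (sum_n_Sm (G := R_AbelianMonoid) (fun i => f ((2*INR i - 1)/(2*INR n))) 1 (pred n) ltac:(lia)). }
(* The right end mirrors the left one: pieces are centred at 1, so [A] and [C] change sign and [u]
   becomes [-u]. *)
assert (T0 := Smid 1 (1-h/2) (1-h/4) ltac:(lra) ltac:(lra) ltac:(lra) ltac:(lra) ltac:(lra)).
assert (K1 := bracket_jump 1 0 (-h^2/24) 0 0 1 (h/6) 0 (h^3/192) (h^4/2304) (1-h/4) (-h/6)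
  ltac:(unfold quartic; field) ltac:(field) ltac:(field) ltac:(field)).
assert (T1 := bracket_decr 1 (h/6) 0 (h^3/192) (h^4/2304) (1-h/4) (1-h/6) ltac:(lra) ltac:(lra) ltac:(lra)
  ltac:(intros x Hx; apply (quartic_nonpos _ _ _ _ _ _ (fun u => (-u)^4 - 2/3*(-u)^3 - (-u)/8 + 1/96));
    [intros; unfold quartic; field|apply (kernel_pieces_nonpos _); assert (H := Hu x 1 (-1/4) (-1/6) ltac:(lra)); lra])).
assert (K2 := bracket_jump 1 (h/6) 0 (h^3/192) (h^4/2304) 1 (-7*h/12) (-h^2/8) (-h^3/192) (-h^4/6912) (1-h/6) (3*h/4)
  ltac:(unfold quartic; field) ltac:(field) ltac:(field) ltac:(field)).
assert (T2 := bracket_decr 1 (-7*h/12) (-h^2/8) (-h^3/192) (-h^4/6912) (1-h/6) (1-h/12) ltac:(lra) ltac:(lra) ltac:(lra)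
  ltac:(intros x Hx; apply (quartic_nonpos _ _ _ _ _ _ (fun u => (-u)^4 + 7/3*(-u)^3 - 3/2*(-u)^2 + (-u)/8 - 1/288));
    [intros; unfold quartic; field|apply (kernel_pieces_nonpos _); assert (H := Hu x 1 (-1/6) (-1/12) ltac:(lra)); lra])).
assert (K3 := bracket_jump 1 (-7*h/12) (-h^2/8) (-h^3/192) (-h^4/6912) 1 (11*h/12) 0 0 0 (1-h/12) (-3*h/2)
  ltac:(unfold quartic; field) ltac:(field) ltac:(field) ltac:(field)).
assert (T3 := bracket_decr 1 (11*h/12) 0 0 0 (1-h/12) 1 ltac:(lra) ltac:(lra) ltac:(lra)
  ltac:(intros x Hx; apply (quartic_nonpos _ _ _ _ _ _ (fun u => (-u)^4 - 11/3*(-u)^3));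
    [intros; unfold quartic; field|apply (kernel_pieces_nonpos _); assert (H := Hu x 1 (-1/12) 0 ltac:(lra)); lra])).
assert (Fin : bracket 1 (11*h/12) 0 0 0 1 = RInt f 0 1 - 11*h/12*f 1).
{ unfold bracket, quartic. field. }
unfold Qmid, Defs.sigma. rewrite Hsum, Rminus_0_r.
replace (1/(12*INR n)) with (h/12) by (unfold h; field; lra).
replace (1/(6*INR n)) with (h/6) by (unfold h; field; lra).
replace (1/(4*INR n)) with (h/4) by (unfold h; field; lra).
replace (11/(12*INR n)) with (11*h/12) by (unfold h; field; lra).
replace (3/(2*INR n)) with (3*h/2) by (unfold h; field; lra).
replace (3/(4*INR n)) with (3*h/4) by (unfold h; field; lra).
replace (1/INR n) with h by (unfold h; field; lra).
unfold left_sum in HL. lra.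
Qed.
End Pieces.

(** * Functions of class C^4 on the unit interval *)

Lemma Ck_on_4_inv (D : R -> Prop) f f4 : Ck_on D 4 f f4 -> exists f1 f2 f3,
  (forall x, D x -> D_in f f1 D x) /\ (forall x, D x -> D_in f1 f2 D x) /\
  (forall x, D x -> D_in f2 f3 D x) /\ (forall x, D x -> D_in f3 f4 D x) /\
  (forall x, D x -> continue_in f4 D x).
Proof.
intros (f1 & H1 & f2 & H2 & f3 & H3 & f4' & H4 & H5 & E).
exists f1, f2, f3; repeat split; trivial.
- intros x Hx eps Heps; rewrite E by assumption. exact (H4 x Hx eps Heps).
- intros x Hx eps Heps; destruct (H5 x Hx eps Heps) as [d [Hd H]]; exists d; split; [exact Hd|].
  intros t Ht; rewrite !E by (trivial; apply Ht). now apply H.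
Qed.

(** Adding a multiple of [x^4] shifts the fourth derivative by a constant, which reduces the mean
    value form of the remainder to a sign statement. *)
Lemma Ck_on_4_comb (D : R -> Prop) f f4 s t : Ck_on D 4 f f4 ->
  Ck_on D 4 (fun x => s * f x + t * x^4) (fun x => s * f4 x + 24 * t).
Proof.
intros H; destruct (Ck_on_4_inv D f f4 H) as (f1 & f2 & f3 & H1 & H2 & H3 & H4 & H5).
assert (HD : forall (g g' p p' : R -> R), (forall x, is_derive p x (p' x)) ->
  (forall x, D x -> D_in g g' D x) ->
  forall x, D x -> D_in (fun x => s * g x + p x) (fun x => s * g' x + p' x) D x).
{ intros g g' p p' Hp Hg x Hx; apply Dadd; [now apply Dmult_const, Hg|].
  apply (D_in_imp _ _ no_cond); [easy|]. apply derivable_pt_lim_D_in, is_derive_Reals, Hp. }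
exists (fun x => s * f1 x + 4*t*x^3); split.
{ apply HD; [intros x; auto_derive; trivial; ring|exact H1]. }
exists (fun x => s * f2 x + 12*t*x^2); split.
{ apply HD; [intros x; auto_derive; trivial; ring|exact H2]. }
exists (fun x => s * f3 x + 24*t*x); split.
{ apply HD; [intros x; auto_derive; trivial; ring|exact H3]. }
exists (fun x => s * f4 x + 24 * t); split.
{ apply (HD f3 f4 (fun x => 24*t*x) (fun _ => 24*t)); [intros x; auto_derive; trivial; ring|exact H4]. }
split; [|trivial]. intros x Hx. apply (limit_plus (fun x => s * f4 x) (fun _ => 24 * t)).
- apply (limit_mul (fun _ => s) f4); [exact (limit_free (fun _ => s) _ 0 x)|now apply H5].
- exact (limit_free (fun _ => 24 * t) _ 0 x).
Qed.

Lemma Ck_on_4_continuous f f4 : Ck_on unit_interval 4 f f4 ->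
  (forall x, continuous (fun x => f (clamp01 x)) x) /\ (forall x, continuous (fun x => f4 (clamp01 x)) x).
Proof.
intros H; destruct (Ck_on_4_inv _ f f4 H) as (f1 & f2 & f3 & H1 & _ & _ & _ & H5).
split; apply continuous_clamp01; [|exact H5].
intros x Hx; apply cont_deriv with f1, H1, Hx.
Qed.

Lemma RInt_clamp01 (f : R -> R) : RInt (fun x => f (clamp01 x)) 0 1 = RInt f 0 1.
Proof.
apply RInt_ext; rewrite Rmin_left, Rmax_right by lra; intros x Hx; rewrite clamp01_id; lra.
Qed.

Lemma Ck_on_4_integrable f f4 : Ck_on unit_interval 4 f f4 -> ex_RInt f 0 1.
Proof.
intros H; apply (ex_RInt_ext (fun x => f (clamp01 x))).
- rewrite Rmin_left, Rmax_right by lra; intros x Hx; rewrite clamp01_id; lra.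
- apply (ex_RInt_continuous (V := R_CompleteNormedModule)); intros x _; now apply (Ck_on_4_continuous f f4).
Qed.

(** * Negative definiteness and error constant of the rule *)

Section Midpoint.

Variable n : nat.
Hypothesis n_ge1 : (1 <= n)%nat.

Let INRn_ge1 : 1 <= INR n.
Proof. apply (le_INR 1), n_ge1. Qed.

Lemma Qmid_ext f g : (forall x, 0 <= x <= 1 -> f x = g x) -> Qmid n f = Qmid n g.
Proof.
intros H; unfold Qmid, Defs.sigma.
assert (Hi : forall q, 1 <= q -> 0 <= 1/(q*INR n) <= 1).
{ intros q Hq; assert (0 < q*INR n) by nra. split.
  - apply Rlt_le, Rdiv_lt_0_compat; lra.
  - apply (Rmult_le_reg_r (q*INR n)); [lra|]. unfold Rdiv; rewrite Rmult_assoc, Rinv_l; nra. }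
assert (H12 := Hi 12 ltac:(lra)). assert (H6 := Hi 6 ltac:(lra)). assert (H4 := Hi 4 ltac:(lra)).
rewrite (sum_n_m_ext_loc _ (fun k => g ((2 * INR k - 1) / (2 * INR n)))).
- rewrite !H by lra; reflexivity.
- intros k Hk. apply H.
  assert (1 <= INR k) by (apply (le_INR 1); lia). assert (INR k <= INR n) by (apply le_INR; lia).
  split.
  + apply Rlt_le, Rdiv_lt_0_compat; lra.
  + apply (Rmult_le_reg_r (2*INR n)); [lra|]. unfold Rdiv; rewrite Rmult_assoc, Rinv_l; lra.
Qed.

Lemma Qmid_comb f g p q : Qmid n (fun x => p * f x + q * g x) = p * Qmid n f + q * Qmid n g.
Proof.
unfold Qmid, Defs.sigma.
rewrite (sum_n_m_comb (fun k => f ((2 * INR k - 1) / (2 * INR n))) (fun k => g ((2 * INR k - 1) / (2 * INR n)))).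
field; lra.
Qed.

Lemma Qmid_remainder_nonpos f f4 : Ck_on unit_interval 4 f f4 ->
  (forall x, 0 <= x <= 1 -> 0 <= f4 x) -> remainder (Qmid n) f <= 0.
Proof.
intros HC Hpos; destruct (Ck_on_4_inv _ f f4 HC) as (f1 & f2 & f3 & H1 & H2 & H3 & H4 & H5).
assert (HI : RInt (fun x => f (clamp01 x)) 0 1 <= Qmid n (fun x => f (clamp01 x))).
{ apply (Qmid_bracket (fun x => f (clamp01 x)) (fun x => f1 (clamp01 x)) (fun x => f2 (clamp01 x))
    (fun x => f3 (clamp01 x)) (fun x => f4 (clamp01 x))); trivial;
  try (apply continuous_clamp01; intros x Hx; eapply cont_deriv; eauto; fail);
  try (intros x Hx; apply is_derive_clamp01; trivial; (apply H1 || apply H2 || apply H3 || apply H4); unfold unit_interval; lra; fail).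
  intros x Hx; apply Hpos, clamp01_bounds. }
rewrite RInt_clamp01 in HI.
rewrite (Qmid_ext (fun x => f (clamp01 x)) f) in HI by (intros; now rewrite clamp01_id).
unfold remainder; lra.
Qed.

Lemma sum_odd_pow4 m : sum_n_m (fun k => (2*INR k - 1)^4) 1 m =
  INR m*(48*INR m^4 - 40*INR m^2 + 7)/15.
Proof.
induction m as [|m IH].
- rewrite sum_n_m_zero by lia.
  match goal with |- zero = ?d => change (0 = d) end. simpl INR. field.
- rewrite sum_n_Sm by lia; rewrite IH, S_INR.
  match goal with |- plus ?a ?b = ?d => change (a + b = d) end. field.
Qed.

Lemma Qmid_remainder_pow4 : remainder (Qmid n) (fun x => x^4) =
  24 * (- (7/(5760*INR n^4)) * (1 - 5/(504*INR n))).
Proof.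
unfold remainder.
rewrite (is_RInt_unique _ _ _ _ (is_RInt_pow01 4)).
unfold Qmid, Defs.sigma.
rewrite (sum_n_m_ext _ (fun k => /(2*INR n)^4 * (2*INR k - 1)^4 + 0 * (2*INR k - 1)^4)).
- rewrite (sum_n_m_comb (fun k => (2*INR k - 1)^4)), sum_odd_pow4. simpl (INR 5). field; lra.
- intros k; match goal with |- ?a = ?b => change (@eq R a b) end. field; lra.
Qed.

(** With [m] and [M] the extrema of the fourth derivative, the sign statement for [f - m*x^4/24] and
    [M*x^4/24 - f] places the remainder between [c*M] and [c*m]; the intermediate value theorem
    supplies [xi]. *)
Lemma Qmid_negative_definite :
  negative_definite 4 (Qmid n) (- (7/(5760*INR n^4)) * (1 - 5/(504*INR n))).
Proof.
assert (HR4 := Qmid_remainder_pow4).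
set (c := - (7/(5760*INR n^4)) * (1 - 5/(504*INR n))) in *.
assert (Hc : c < 0).
{ assert (0 < 7/(5760*INR n^4)).
  { apply Rdiv_lt_0_compat; [lra|]. apply Rmult_lt_0_compat; [lra|apply pow_lt; lra]. }
  assert (5/(504*INR n) < 1).
  { apply (Rmult_lt_reg_r (504*INR n)); [lra|]. unfold Rdiv; rewrite Rmult_assoc, Rinv_l; lra. }
  unfold c; nra. }
split; [exact Hc|].
intros f fr HC.
assert (Hcomb : forall s t, remainder (Qmid n) (fun x => s * f x + t * x^4) =
  s * remainder (Qmid n) f + t * (24 * c)).
{ intros s t; rewrite <- HR4; unfold remainder; rewrite (Qmid_comb f (fun x => x^4)).
  assert (If := RInt_correct _ _ _ (Ck_on_4_integrable f fr HC)).
  rewrite (is_RInt_unique (fun x => s * f x + t * x^4) 0 1 (s * RInt f 0 1 + t * RInt (fun x => x^4) 0 1)).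
  - ring.
  - apply (is_RInt_plus (V := R_NormedModule) (fun x => s * f x) (fun x => t * x^4)).
    + apply (is_RInt_scal (V := R_NormedModule) f), If.
    + rewrite (is_RInt_unique _ _ _ _ (is_RInt_pow01 4)).
      apply (is_RInt_scal (V := R_NormedModule) (fun x => x^4)), is_RInt_pow01. }
assert (Cfr : forall x, continuity_pt (fun x => fr (clamp01 x)) x).
{ intros x; apply continuity_pt_filterlim, (Ck_on_4_continuous f fr HC). }
destruct (continuity_ab_min (fun x => fr (clamp01 x)) 0 1) as (xm & Hm & Hxm); [lra|intros; apply Cfr|].
destruct (continuity_ab_maj (fun x => fr (clamp01 x)) 0 1) as (xM & HM & HxM); [lra|intros; apply Cfr|].
set (m := fr (clamp01 xm)) in *. set (M := fr (clamp01 xM)) in *.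
assert (H1 : remainder (Qmid n) f <= c * m).
{ assert (H := Qmid_remainder_nonpos _ _ (Ck_on_4_comb _ _ _ 1 (-m/24) HC)).
  rewrite Hcomb in H.
  assert (1 * remainder (Qmid n) f + -m/24 * (24 * c) <= 0); [|lra]. apply H.
  intros x Hx; generalize (Hm x Hx); rewrite clamp01_id by assumption; lra. }
assert (H2 : c * M <= remainder (Qmid n) f).
{ assert (H := Qmid_remainder_nonpos _ _ (Ck_on_4_comb _ _ _ (-1) (M/24) HC)).
  rewrite Hcomb in H.
  assert (-1 * remainder (Qmid n) f + M/24 * (24 * c) <= 0); [|lra]. apply H.
  intros x Hx; generalize (HM x Hx); rewrite clamp01_id by assumption; lra. }
set (v := remainder (Qmid n) f) in *.
assert (Hv : v = c * (v/c)) by (field; lra).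
destruct (IVT_gen (fun x => fr (clamp01 x)) xm xM (v/c)) as (xi & _ & Hxi).
- intros x; apply Cfr.
- fold m M. assert (m <= v/c <= M).
  { clear - Hv Hc H1 H2; set (r := v/c) in *; clearbody r.
    split; apply (Rmult_le_reg_l (-c)); lra. }
  rewrite Rmin_left, Rmax_right; lra.
(* [IVT_gen] is applied to the extended function on the line, so its point is retracted to the unit
   interval. *)
- exists (clamp01 xi); split; [apply clamp01_bounds|]. rewrite Hxi; exact Hv.
Qed.
End Midpoint.

(** * The rule and its asymptotic optimality *)

(* All nodes are multiples of [1/(12 n)]; this is the numerator of the [i]-th one. *)
Definition Qmid_node (n i : nat) : nat :=
  if Nat.leb i 4 then i - 1
  else if Nat.leb i (n + 4) then 12 * (i - 4) - 6
  else 12 * n + i - (n + 8).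

Definition end_weight (n i : nat) : R :=
  match i with
  | 1%nat => 11 / (12 * INR n)
  | 2%nat => - (3 / (2 * INR n))
  | 3%nat => 3 / (4 * INR n)
  | _ => - (1 / (6 * INR n))
  end.

(** Reflection about 1/2 sends index [i] to [n+9-i], so the last four weights are read off the first
    four. *)
Definition Qmid_weight (n i : nat) : R :=
  if Nat.leb i 4 then end_weight n i
  else if Nat.leb i (n + 4) then 1 / INR n
  else end_weight n (n + 9 - i).

Lemma sum_n_m_shift (u : nat -> R) k n m :
  sum_n_m (fun i => u (k + i)%nat) n m = sum_n_m u (k + n) (k + m).
Proof.
revert u; induction k as [|k IH]; intros u; [reflexivity|].
exact (eq_trans (IH (fun i => u (S i))) (sum_n_m_S u _ _)).
Qed.

Lemma Qmid_quadrature n : (1 <= n)%nat -> quadrature_formula (n + 8) (Qmid n).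
Proof.
intros Hn1.
assert (Hn : 1 <= INR n) by (apply (le_INR 1), Hn1).
exists (Qmid_weight n), (fun i => INR (Qmid_node n i) / (12 * INR n)).
assert (Hlt : forall p q, (p < q)%nat -> INR p / (12 * INR n) < INR q / (12 * INR n)).
{ intros p q Hpq; apply Rmult_lt_compat_r; [apply Rinv_0_lt_compat; lra|now apply lt_INR]. }
repeat split.
- apply Rmult_le_pos; [apply pos_INR|apply Rlt_le, Rinv_0_lt_compat; lra].
- assert (Hle : (Qmid_node n i <= 12 * n)%nat).
  { unfold Qmid_node; destruct (Nat.leb_spec i 4); [lia|]. destruct (Nat.leb_spec i (n+4)); lia. }
  apply le_INR in Hle. rewrite mult_INR in Hle. simpl (INR 12) in Hle.
  apply (Rmult_le_reg_r (12 * INR n)); [lra|]. unfold Rdiv; rewrite Rmult_assoc, Rinv_l; lra.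
- intros i j Hi Hij Hj; apply Hlt. unfold Qmid_node.
  destruct (Nat.leb_spec i 4), (Nat.leb_spec j 4); try lia;
  destruct (Nat.leb_spec j (n+4)); try lia; destruct (Nat.leb_spec i (n+4)); lia.
- intros f.
  set (t := fun i => Qmid_weight n i * f (INR (Qmid_node n i) / (12 * INR n))).
  rewrite (sum_n_m_Chasles t 1 4 (n+8)) by lia.
  rewrite (sum_n_m_Chasles t 5 (n+4) (n+8)) by lia.
  assert (E1 : sum_n_m t 1 4 = t 1%nat + t 2%nat + t 3%nat + t 4%nat).
  { rewrite 3!sum_n_Sm, sum_n_n by lia. reflexivity. }
  assert (E2 : sum_n_m t 5 (n+4) = 1/INR n * sum_n_m (fun k => f ((2 * INR k - 1) / (2 * INR n))) 1 n).
  { replace (n+4)%nat with (4+n)%nat by lia. change 5%nat with (4+1)%nat. rewrite <- (sum_n_m_shift t 4 1 n).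
    rewrite <- (sum_n_m_mult_l (K := R_Ring)). apply sum_n_m_ext_loc. intros k Hk.
    unfold t, Qmid_weight, Qmid_node.
    destruct (Nat.leb_spec (4+k) 4); [lia|]. destruct (Nat.leb_spec (4+k) (n+4)); [|lia].
    change (@mult R_Ring) with Rmult. f_equal; f_equal.
    replace (12 * (4 + k - 4) - 6)%nat with (6*(2*k-1))%nat by lia.
    rewrite mult_INR, minus_INR, mult_INR by lia. simpl INR. field; lra. }
  assert (E3 : sum_n_m t (S (n+4)) (n+8) = t (n+5)%nat + t (n+6)%nat + t (n+7)%nat + t (n+8)%nat).
  { replace (n+8)%nat with (S (S (S (S (n+4))))) by lia.
    rewrite 3!sum_n_Sm, sum_n_n by lia.
    replace (n+5)%nat with (S (n+4)) by lia. replace (n+6)%nat with (S (S (n+4))) by lia.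
    replace (n+7)%nat with (S (S (S (n+4)))) by lia. reflexivity. }
  rewrite E1, E2, E3.
  match goal with |- _ = plus ?a (plus ?b ?d) => change (Qmid n f = a + (b + d)) end.
  assert (L : forall i, (i <= 4)%nat -> t i = end_weight n i * f (INR (i-1) / (12*INR n))).
  { intros i Hi; unfold t, Qmid_weight, Qmid_node. now destruct (Nat.leb_spec i 4); [|lia]. }
  assert (T : forall j, (1 <= j <= 4)%nat -> t (n+9-j)%nat = end_weight n j * f (1 - INR (j-1) / (12*INR n))).
  { intros j Hj; unfold t, Qmid_weight, Qmid_node.
    destruct (Nat.leb_spec (n+9-j) 4); [lia|]. destruct (Nat.leb_spec (n+9-j) (n+4)); [lia|].
    replace (n + 9 - (n + 9 - j))%nat with j by lia. f_equal; f_equal.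
    replace (12 * n + (n + 9 - j) - (n + 8))%nat with (12*n - (j-1))%nat by lia.
    rewrite minus_INR, mult_INR by lia. simpl (INR 12). field; lra. }
  assert (T1 := T 1%nat ltac:(lia)). assert (T2 := T 2%nat ltac:(lia)).
  assert (T3 := T 3%nat ltac:(lia)). assert (T4 := T 4%nat ltac:(lia)).
  replace (n+9-1)%nat with (n+8)%nat in T1 by lia. replace (n+9-2)%nat with (n+7)%nat in T2 by lia.
  replace (n+9-3)%nat with (n+6)%nat in T3 by lia. replace (n+9-4)%nat with (n+5)%nat in T4 by lia.
  rewrite T1, T2, T3, T4, !L by lia. simpl (_ - 1)%nat. simpl INR. unfold end_weight, Qmid, Defs.sigma.
  replace (0 / (12*INR n)) with 0 by (field; lra).
  replace ((1+1) / (12*INR n)) with (1/(6*INR n)) by (field; lra).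
  replace ((1+1+1) / (12*INR n)) with (1/(4*INR n)) by (field; lra).
  ring.
Qed.

Lemma c_minus_bounds N Q c : (2 <= N)%nat -> quadrature_formula N Q -> negative_definite 4 Q c ->
  c <= c_minus N 4 <= - (7 / (5760 * INR N^4)).
Proof.
intros HN HQ Hc.
set (E := fun c => exists Q, quadrature_formula N Q /\ negative_definite 4 Q c).
assert (HE : E c) by (exists Q; split; assumption).
assert (Hub : forall d, E d -> d <= - (7 / (5760 * INR N^4))).
{ intros d (P & (a & tau & H01 & Hinc & HP) & Hd).
  apply (negative_definite_upper_bound N a tau H01 P d HP Hd HN Hinc). }
unfold c_minus; fold E.
destruct (Lub_Rbar_correct E) as [H1 H2].
assert (H3 := H1 c HE). assert (H4 := H2 (Finite (- (7 / (5760 * INR N^4)))) Hub).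
(* The supremum is finite, being at least [c] and bounded above, so [real] does not return its
   default value 0. *)
destruct (Lub_Rbar E) as [l| |]; simpl in *; [split; assumption|contradiction|contradiction].
Qed.

(** Since [c n <= c_minus (n+8) 4 <= -7/(5760*(n+8)^4) < 0] and [c n >= -7/(5760*n^4)], the ratio
    lies between 1 and [(1+8/n)^4]. *)
Lemma Qmid_asymptotically_optimal :
  asymptotically_optimal_negative_definite 4 (fun n => (n + 8)%nat) Qmid.
Proof.
set (c := fun n => - (7/(5760*INR n^4)) * (1 - 5/(504*INR n))).
exists c; split.
{ intros n Hn; split; [now apply Qmid_quadrature|now apply Qmid_negative_definite]. }
apply (is_lim_seq_le_le_loc (fun _ => 1) _ (fun n => (1 + 8 * / INR n)^4)).
- exists 1%nat; intros n Hn.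
  assert (Hn1 : 1 <= INR n) by (apply (le_INR 1), Hn).
  destruct (c_minus_bounds (n+8) (Qmid n) (c n) ltac:(lia) (Qmid_quadrature n Hn) (Qmid_negative_definite n Hn)) as [H1 H2].
  set (d := c_minus (n+8) 4) in *.
  rewrite plus_INR in H2. simpl (INR 8) in H2.
  assert (Hp : 0 < (INR n + 8)^4) by (apply pow_lt; lra).
  assert (Hp' : 0 < INR n^4) by (apply pow_lt; lra).
  replace (INR n + (1 + 1 + 1 + 1 + 1 + 1 + 1 + 1)) with (INR n + 8) in H2 by ring.
  assert (Hpos : 0 < 7 / (5760 * (INR n + 8)^4)) by (apply Rdiv_lt_0_compat; lra).
  split; apply (Rmult_le_reg_r (- d)); try lra; replace (c n / d * - d) with (- c n) by (field; lra).
  + lra.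
  + apply Rle_trans with (7/(5760*INR n^4)).
    * assert (0 < 7/(5760*INR n^4)) by (apply Rdiv_lt_0_compat; lra).
      assert (0 < 5/(504*INR n)) by (apply Rdiv_lt_0_compat; lra).
      unfold c; nra.
    * replace (7/(5760*INR n^4)) with ((1 + 8 * / INR n)^4 * (7 / (5760 * (INR n + 8)^4)))
        by (field; lra).
      apply Rmult_le_compat_l; [apply pow_le|lra].
      assert (0 < / INR n) by (apply Rinv_0_lt_compat; lra). lra.
- apply is_lim_seq_const.
- assert (H0 : is_lim_seq (fun n => / INR n) 0).
  { apply (is_lim_seq_inv INR p_infty); [apply is_lim_seq_INR|easy]. }
  assert (H1 : is_lim_seq (fun n => 1 + 8 * / INR n) 1).
  { replace (Finite 1) with (Finite (1 + 8 * 0)) by (f_equal; ring).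
    apply is_lim_seq_plus'; [apply is_lim_seq_const|].
    apply (is_lim_seq_scal_l (fun n => / INR n) 8 0), H0. }
  replace (Finite 1) with (Finite (1^4)) by (f_equal; ring).
  apply (is_lim_seq_continuous (fun x => x^4)); [|exact H1].
  apply continuity_pt_filterlim, @ex_derive_continuous; auto_derive; trivial.
Qed.

Theorem mainTheorem8 :
  (forall n : nat, (1 <= n)%nat ->
     quadrature_formula (n + 8) (Qmid n) /\
     negative_definite 4 (Qmid n)
       (- (7 / (5760 * INR n ^ 4)) * (1 - 5 / (504 * INR n)))) /\
  asymptotically_optimal_negative_definite 4 (fun n => (n + 8)%nat) Qmid.
Proof.
split; [|exact Qmid_asymptotically_optimal].
intros n Hn; split; [now apply Qmid_quadrature|now apply Qmid_negative_definite].
Qed.
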